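(* Let $q$ be an odd prime power and let $d$ be an integer such that either ($d\ge3$ is odd) or ($d\equiv 2\bmod 4$ and $q\equiv 3\bmod 4$). Let $P=A\times B$ with $A,B\subset\mathbb{F}_q^d$ and let $R$ be a set of rigid motions in $\mathbb{F}_q^d$. (1) If $|A|<q^{\frac{d-1}{2}}$, then $$\left| I(P,R)-\frac{|P||R|}{q^d}\right|\ll q^{(d^2-d)/4}\sqrt{|P||R|}.$$ (2) If $q^{\frac{d-1}{2}}\le|A|\le q^{\frac{d+1}{2}}$, then $$\left| I(P,R)-\frac{|P||R|}{q^d}\right|\ll q^{(d^2-2d+1)/4}\sqrt{|P||R||A|}.$$
   Context: $\mathbb{F}_q$ is the finite field with $q$ elements; $d$ is a positive integer. $O(d)$ is the group of $d\times d$ orthogonal matrices over $\mathbb{F}_q$ (those preserving $\|x\|=x_1^2+\cdots+x_d^2$). A rigid motion is a map $x\mapsto gx+z$ with $g\in O(d)$, $z\in\mathbb{F}_q^d$, identified with the pair $(g,z)$; so $R\subset O(d)\times\mathbb{F}_q^d$. The number of incidences is $I(P,R)=\#\{(x,y,g,z): (x,y)\in P,\ (g,z)\in R,\ x=gy+z\}$. $X\ll Y$ means $|X|\le CY$ for an absolute constant $C>0$; implicit constants may depend on $d$ only. *)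

(* Defs.v *)
From HB Require Import structures.
From mathcomp Require Import all_boot all_order all_algebra.

Set Implicit Arguments.
Unset Strict Implicit.
Unset Printing Implicit Defensive.

Import GRing.Theory.
Local Open Scope ring_scope.

Section RigidMotions.
Variables (F : finFieldType) (d : nat).

Definition sqnorm (x : 'cV[F]_d) : F := \sum_(i < d) x i 0 ^+ 2.

Definition orthogonal_group : {set 'M[F]_d} :=
  [set g : 'M[F]_d | [forall x : 'cV[F]_d, sqnorm (g *m x) == sqnorm x]].

(* The pair (g, z) stands for the map x |-> g x + z. *)
Definition rigid_motions : {set 'M[F]_d * 'cV[F]_d} :=
  setX orthogonal_group [set: 'cV[F]_d].

Definition num_incidences (P : {set 'cV[F]_d * 'cV[F]_d})
    (R : {set 'M[F]_d * 'cV[F]_d}) : nat :=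
  #|[set t in setX P R | t.1.1 == t.2.1 *m t.1.2 + t.2.2]|.

End RigidMotions.

Arguments orthogonal_group : clear implicits.
Arguments rigid_motions : clear implicits.

(* Main.v *)
Require Import Defs.
From HB Require Import structures.
From mathcomp Require Import all_boot all_order all_algebra.
From mathcomp Require Import all_fingroup all_solvable all_field.
From mathcomp Require Import reals exp.
From mathcomp Require Import ring lra zify.

Set Implicit Arguments.
Unset Strict Implicit.
Unset Printing Implicit Defensive.

Import Order.TTheory GRing.Theory Num.Theory.
Local Open Scope ring_scope.

(** Write q for the order of F, chi for a nontrivial additive character of F
    and Ahat(m) for the sum of chi(m.x) over x in A.  Detecting the incidence
    x = g y + z by the characters m |-> chi(m.(x - g y - z)), the frequency
    m = 0 gives the main term |P||R|/q^d and the others give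

      q^d I - |P||R| = sum_((g, z) in R) W(g, z),
      W(g, z) = sum_(m <> 0) Ahat(m) conj(Bhat(g^T m)) chi(- m.z).

    By Cauchy-Schwarz over R, extending the sum to all rigid motions, and by
    Plancherel in z, the square of the left-hand side is at most |R| q^d times
    the sum over g in O(d) and m <> 0 of |Ahat(m)|^2 |Bhat(g^T m)|^2.  As g
    runs over O(d) the vector g^T m stays on the sphere of m, and it reaches
    each point at most S times, where S bounds the stabilisers of nonzero
    vectors (card_orthogonal_transport).  Hence the square is at most
    |R| q^(2d) |B| S E, where E is the largest sum of |Ahat|^2 over a sphere
    (incidence_fluctuation_bound).

    The energy E is a sum over pairs of points of A of the Fourier transform
    of a sphere.  The diagonal contributes O(q^(d-1) |A|), and off the
    diagonal this transform is at most 2 q^((d-1)/2) (sphere_decay), so that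
    E = O(q^(d-1) |A| + q^((d-1)/2) |A|^2) (sphere_energy).  The two ranges of
    |A| in the theorem are those where the first or the second term wins.

    Completing squares writes the transform of a sphere as a sum of
    gauss(s)^d chi(a s + b / s) over s <> 0.  If d is odd this is a Salie sum,
    which is evaluated by elementary means (salie_bound).  If d = 2 (mod 4) and
    q = 3 (mod 4), then gauss(s)^d = - q^(d/2) does not depend on s; the case
    a = b = 0, where the sum over s is large, then comes with a favourable
    sign, and the case a, b <> 0 leads to Kloosterman sums, for which Weil's
    bound is needed.

    Weil's bound (kloosterman_bound) is proved as follows.  Over the quadratic
    extension of a field with Q elements, the lifted Kloosterman sum is
    2 Q - K^2 (kloosterman_double).  So along the tower of fields with
    q^(2^j) elements the normalised sum t = - K / sqrt Q obeys
    t |-> t^2 - 2, and it grows without bound if K^2 > 4 q.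
    On the other hand the sum of the Kloosterman sums of the p - 1 nontrivial
    powers of chi counts points on y^p - y = x + a / x, and has a lower bound
    - C_p sqrt Q in every field of the tower (artin_schreier_count), while
    each of its terms is at most 2 sqrt Q by the doubling formula; so t stays
    bounded.  The count of points rests on Stepanov's method (stepanov). *)

(** * Stepanov's method for the values of a quadratic character *)

(** X divides f - f(0), and taking r-th powers is additive in characteristic p. *)
Lemma polyX_dvd_expX_sub (E : fieldType) (f : {poly E}) p r :
  p \in [pchar E] -> p.-nat r ->
  'X^r %| f ^+ r - (f.[0] ^+ r)%:P.
Proof.
move=> pE pr; have pP : p \in [pchar {poly E}] by rewrite pchar_poly.
have prP : [pchar {poly E}].-nat r.
  by rewrite (eq_pnat _ (pcharf_eq pP)).
rewrite polyC_exp -exprNn_pchar // -exprDn_pchar //.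
apply: dvdp_exp2r; rewrite -['X]subr0 -polyC0 dvdp_XsubCl rootE !hornerE.
by rewrite subrr.
Qed.

(** After removing the common factors of P and R, coprimality forces P to be
    constant, so f would be a constant times R^2.  Then R divides both f and its
    derivative, hence is constant, and so is f. *)
Lemma separable_not_square (E : fieldType) (f P R : {poly E}) (c : E) :
  separable_poly f -> (1 < size f)%N -> c != 0 ->
  P ^+ 2 * f = c *: R ^+ 2 -> P = 0.
Proof.
move=> sepf szf c0 eqPR; apply/eqP/negP => /negP P0.
have g0 : gcdp P R != 0 by rewrite gcdp_eq0 negb_and P0.
set g := gcdp P R in g0.
have [P' defP] : exists P', P = P' * g.
  by exists (P %/ g); rewrite divpK // dvdp_gcdl.
have [R' defR] : exists R', R = R' * g.
  by exists (R %/ g); rewrite divpK // dvdp_gcdr.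
have P'0 : P' != 0 by apply: contraNneq P0 => P'0; rewrite defP P'0 mul0r.
have copPR : coprimep P' R'.
  have := coprimep_div_gcd (p:=P) (q:=R); rewrite P0 => /(_ isT).
  by rewrite -/g {1}defP {1}defR !mulpK.
have eq' : P' ^+ 2 * f = c *: R' ^+ 2.
  have g2 : g ^+ 2 != 0 by rewrite expf_neq0.
  apply: (mulIf g2); move: eqPR; rewrite defP defR !exprMn -scalerAl => <-.
  by rewrite mulrAC.
have szP' : size (P' ^+ 2) = 1%N.
  apply/eqP; rewrite -coprimepp.
  have d : P' ^+ 2 %| R' ^+ 2.
    by rewrite -(dvdpZr _ _ c0) -eq' dvdp_mulr.
  by apply: (coprimep_dvdl d); rewrite coprimep_expl // coprimep_expr //.
have [u u0 Pu] := size_poly1P _ (introT eqP szP').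
have deff : f = (u^-1 * c) *: R' ^+ 2.
  by rewrite -scalerA -eq' Pu mul_polyC scalerA mulVf // scale1r.
have dR1 : R' %| f by rewrite deff dvdpZr ?mulf_neq0 ?invr_eq0 // dvdp_exp.
have dR2 : R' %| f^`().
  by rewrite deff derivZ dvdpZr ?mulf_neq0 ?invr_eq0 // deriv_exp expr1 -mulrnAl dvdp_mull.
have : size R' == 1%N.
  rewrite -coprimepp; apply: (coprimep_dvdl dR1); rewrite coprimep_sym.
  by apply: (coprimep_dvdl dR2); rewrite unlock in sepf.
case/size_poly1P => v v0 Rv; move: szf.
by rewrite deff Rv -polyC_exp -mul_polyC -polyCM size_polyC; case: (_ != 0).
Qed.

(** The values x with f(x)^((Q-1)/2) = eps, where Q = r^2, are trapped among the
    roots of one auxiliary polynomial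

      H = sum_(j < J) X^(r j) (P_j + R_j f^s),    s = (r - 1)/2.

    Since r is a power of the characteristic, H^r has coefficients P_j^r and
    R_j^r; at such an x, where x^Q = x, the product H(x)^r f(x)^s equals

      sum_(j < J) x^j (P_j^r f^s + eps R_j^r)(x),

    a polynomial of much lower degree.  There are more choices of (P, R) than
    polynomials of that degree, so by the pigeonhole principle some nonzero
    (P, R) makes it vanish identically, and then H vanishes at every such x.
    Since r is large, this needs no derivatives: vanishing of H at x already
    is vanishing to order r of H^r.  Finally H is not zero: modulo X^r its
    lowest nonzero block would give P_k^2 f = f(0)^r R_k^2. *)
Lemma stepanov (E : finFieldType) p s h (f : {poly E}) (eps : E) :
  let r := s.*2.+1 in
  p \in [pchar E] -> p.-nat r -> #|E| = (r * r)%N ->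
  size f = h.*2.+1 -> f.[0] != 0 -> separable_poly f ->
  (0 < h <= s)%N -> eps != 0 ->
  (#|[set x : E | f.[x] ^+ (s * r.+1) == eps]| <= r * (s + h.*2))%N.
Proof.
move=> r pE pr cE szf f0 sepf /andP[h0 hs] eps0.
have pP : p \in [pchar {poly E}] by rewrite pchar_poly.
have prE : [pchar E].-nat r by rewrite (eq_pnat _ (pcharf_eq pE)).
have prP : [pchar {poly E}].-nat r by rewrite (eq_pnat _ (pcharf_eq pP)).
pose J := (s + h)%N; pose N := (J + r * s)%N.
pose a := (s - h).+1; pose b := s.+1.
pose T := {ffun 'I_J -> 'rV[E]_a * 'rV[E]_b}.
pose D (u : T) : {poly E} := \sum_(j < J)
  'X^j * (rVpoly (u j).1 ^+ r * f ^+ s + eps *: rVpoly (u j).2 ^+ r).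
have szX (k n : nat) (x : 'rV[E]_k.+1) : (size (rVpoly x ^+ n) <= k * n + 1)%N.
  rewrite (leq_trans (size_poly_exp_leq _ _)) // addn1 ltnS leq_mul2r.
  case: n => //= n; rewrite -subn1 leq_subLR add1n.
  exact: size_poly.
have szfs n : (size (f ^+ n) <= h.*2 * n + 1)%N.
  by rewrite (leq_trans (size_poly_exp_leq _ _)) // szf addn1.
have szD u : (size (D u) <= N)%N.
  apply: (leq_trans (size_sum _ _ _)); apply/bigmax_leqP => j _.
  apply: (leq_trans (size_polyMleq _ _)); rewrite size_polyXn /=.
  have := ltn_ord j; rewrite /N => ltj.
  have aux m : (m <= r * s + 1)%N -> ((j.+1 + m).-1 <= J + r * s)%N.
    by clear -ltj; lia.
  apply: aux.
  apply: (leq_trans (size_polyD _ _)); rewrite geq_max; apply/andP; split.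
    apply: (leq_trans (size_polyMleq _ _)).
    have := szX _ r (u j).1; have := szfs s; rewrite -/r.
    have : ((s - h) * r + h * r = r * s)%N by rewrite -mulnDl subnK // mulnC.
    have : (h * r = h.*2 * s + h)%N by rewrite /r mulnS -doubleMl -doubleMr addnC.
    move: (size _) (size _) ((s - h) * r)%N (h * r)%N (r * s)%N (_ * s)%N.
    by clear; lia.
  apply: (leq_trans (size_scale_leq _ _)).
  by have := szX _ r (u j).2; rewrite mulnC.
pose Phi (u : T) : 'rV[E]_N := poly_rV (D u).
have PhiD u : D u = rVpoly (Phi u) by rewrite poly_rV_K.
(* There are J (a + b) free coefficients against N equations. *)
have [u [v [neq_uv eqD]]] : exists u v, u != v /\ D u = D v.
  have /injectivePn[u [v neq_uv eqPhi]] : ~~ injectiveb Phi.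
    apply/negP => /injectiveP/leq_card; apply/negP; rewrite -ltnNge.
    rewrite card_mx mul1n card_ffun card_prod !card_mx !mul1n card_ord.
    rewrite -expnD -expnM ltn_exp2l ?finNzRing_gt1 //.
    rewrite /N /J /a /b /r; nia.
  by exists u, v; rewrite !PhiD eqPhi.
pose P j := rVpoly ((u j).1 - (v j).1).
pose R j := rVpoly ((u j).2 - (v j).2).
have D0 : \sum_(j < J) 'X^j * (P j ^+ r * f ^+ s + eps *: R j ^+ r) = 0.
  rewrite -[RHS](subrr (D v)) -{1}eqD /D -sumrB; apply: eq_bigr => j _.
  rewrite /P /R !linearB /= !exprDn_pchar // !exprNn_pchar //.
  by rewrite scalerDr scalerN -mulrBr mulrDl mulNr addrACA opprD.
have [k [Pk0 kmin]] : exists k : 'I_J, ((P k != 0) || (R k != 0)) /\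
    forall j : 'I_J, (j < k)%N -> P j = 0 /\ R j = 0.
  have exk : exists k : 'I_J, (P k != 0) || (R k != 0).
    apply/existsP; rewrite -[[exists _, _]]negbK; apply: contra neq_uv.
    rewrite negb_exists => /forallP all0; apply/eqP/ffunP => j.
    have := all0 j; rewrite negb_or !negbK => /andP[].
    rewrite /P /R; move: (u j) (v j) => [u1 u2] [v1 v2] /=.
    by rewrite !(raddf_eq0 _ (can_inj (@rVpolyK _ _))) !subr_eq0 => /eqP-> /eqP->.
  have [k Hk kmin] := arg_minnP (fun k : 'I_J => k : nat) (xchooseP exk).
  exists k; split=> // j; rewrite ltnNge => jk.
  by case: (eqVneq (P j) 0) (eqVneq (R j) 0) => [-> [-> //|Rj]|Pj _];
    case/negP: jk; apply: kmin; rewrite ?Rj ?Pj ?orbT.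
pose H := \sum_(j < J) 'X^(r * j) * (P j + R j * f ^+ s).
have H0 : H != 0.
  apply: contraTneq Pk0 => H0; rewrite negb_or !negbK.
  (* All blocks below k vanish and those above are divisible by X^(r (k+1)). *)
  have dvdk : 'X^r %| P k + R k * f ^+ s.
    rewrite -(dvdp_mul2l _ _ (monic_neq0 (monicXn _ (r * k)))) -exprD -mulnSr.
    have -> : 'X^(r * k) * (P k + R k * f ^+ s) =
        - \sum_(j < J | j != k) 'X^(r * j) * (P j + R j * f ^+ s).
      by move/eqP: H0; rewrite /H (bigD1 k) //= addr_eq0 => /eqP.
    rewrite dvdpNr; elim/big_rec: _ => [|j y jk dy]; first exact: dvdp0.
    rewrite dvdp_add //; case: (ltngtP j k) => [/kmin[-> ->]|ltkj|/val_inj ejk].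
    - by rewrite mul0r addr0 mulr0 dvdp0.
    - by rewrite dvdp_mulr // dvdp_exp2l // leq_mul2l ltkj orbT.
    - by rewrite ejk eqxx in jk.
  have dvd1 : 'X^r %| P k ^+ 2 * f - R k ^+ 2 * f ^+ r.
    have -> : P k ^+ 2 * f - R k ^+ 2 * f ^+ r =
        (P k + R k * f ^+ s) * ((P k - R k * f ^+ s) * f).
      rewrite mulrA [X in _ = X * f]mulrC -subr_sqr mulrBl exprMn -exprM muln2.
      by rewrite -[R k ^+ 2 * f ^+ s.*2 * f]mulrA -exprSr.
    exact: dvdp_mulr.
  have dvd2 : 'X^r %| P k ^+ 2 * f - f.[0] ^+ r *: R k ^+ 2.
    have -> : P k ^+ 2 * f - f.[0] ^+ r *: R k ^+ 2 =
        (P k ^+ 2 * f - R k ^+ 2 * f ^+ r) +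
        R k ^+ 2 * (f ^+ r - (f.[0] ^+ r)%:P).
      by rewrite mulrBr addrA subrK [_ * _%:P]mulrC mul_polyC.
    by rewrite dvdp_add // dvdp_mull // (polyX_dvd_expX_sub _ pE).
  (* The degree bounds on P and R were chosen so that both sides have degree
     less than r, and the congruence modulo X^r is an equality. *)
  have eqPR : P k ^+ 2 * f = f.[0] ^+ r *: R k ^+ 2.
    apply/eqP; rewrite -subr_eq0; apply: contraTT dvd2 => nz.
    apply/negP => /(dvdp_leq nz); apply/negP; rewrite -ltnNge size_polyXn ltnS.
    apply: (leq_trans (size_polyD _ _)); rewrite size_polyN geq_max.
    apply/andP; split.
      apply: (leq_trans (size_polyMleq _ _)); rewrite szf.
      have := szX _ 2 ((u k).1 - (v k).1); rewrite -/(P k) /r.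
      by move: (size _) => m; clear -hs; lia.
    apply: (leq_trans (size_scale_leq _ _)).
    have := szX _ 2 ((u k).2 - (v k).2); rewrite -/(R k) /r.
    by move: (size _) => m; clear; lia.
  have Pk : P k = 0.
    by apply: (separable_not_square sepf _ _ eqPR); rewrite ?expf_neq0 // szf ltnS double_gt0.
  move/eqP: eqPR; rewrite Pk expr0n mul0r eq_sym scaler_eq0 !expf_eq0.
  by rewrite (negPf f0) andbF /= => /eqP ->; rewrite !eqxx.
have szH : (size H <= r * (s + h.*2) + 1)%N.
  apply: (leq_trans (size_sum _ _ _)); apply/bigmax_leqP => j _.
  apply: (leq_trans (size_polyMleq _ _)); rewrite size_polyXn /=.
  have szk n (x : 'rV[E]_n) : (size (rVpoly x) <= n)%N by exact: size_poly.
  have := ltn_ord j; rewrite /N => ltj.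
  have aux m : (m <= s + h.*2 * s + 1)%N ->
      (((r * j).+1 + m).-1 <= r * (s + h.*2) + 1)%N.
    by clear -ltj; rewrite /J /r in ltj *; nia.
  apply: aux.
  apply: (leq_trans (size_polyD _ _)); rewrite geq_max; apply/andP; split.
    have := szk _ ((u j).1 - (v j).1); rewrite -/(P j) /a.
    by move: (size _) (h.*2 * s)%N; clear; lia.
  apply: (leq_trans (size_polyMleq _ _)).
  have := szk _ ((u j).2 - (v j).2); rewrite -/(R j) /b; have := szfs s.
  by move: (size _) (size _) (h.*2 * s)%N; clear; lia.
rewrite cardE -ltnS -[X in (_ < X)%N]addn1; apply: leq_trans szH.
apply: max_poly_roots => //; last exact: enum_uniq.
apply/allP => x; rewrite mem_enum inE => /eqP fx.
have fx0 : f.[x] != 0.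
  by apply: contraNneq eps0 => fx0; rewrite -fx fx0 expr0n; case: (s) h0 hs => //; case: (h).
have xQ : x ^+ (r * r) = x by rewrite -cE expf_card.
suff Hr0 : H.[x] ^+ r * f.[x] ^+ s = 0.
  move/eqP: Hr0; rewrite mulf_eq0 (negPf (expf_neq0 s fx0)) orbF.
  by rewrite expf_eq0 => /andP[].
have := congr1 (horner^~ x) D0; rewrite horner0 /= => <-.
rewrite /H !horner_sum.
rewrite (big_morph (fun y => y ^+ r) (fun y z => exprDn_pchar y z prE) (expr0n _ _)).
rewrite mulr_suml; apply: eq_bigr => j _.
rewrite !hornerE exprMn exprDn_pchar // exprMn -!exprM.
have -> : x ^+ (r * j * r) = x ^+ j by rewrite mulnAC exprM xQ.
rewrite -mulrA mulrDl -mulrA -exprD.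
have -> : (s * r + s = s * r.+1)%N by rewrite mulnS addnC.
by rewrite fx [eps * _]mulrC.
Qed.

(** * Squares and additive characters of finite fields *)

Section Squares.
Variable F : finFieldType.
Hypothesis oddF : odd #|F|.

(** Translating by x permutes V and so preserves the sum of all elements. *)
Lemma card_mulr_eq0 (V : finZmodType) (x : V) : x *+ #|V| = 0.
Proof.
have : \sum_(y : V) y = \sum_y (y + x) by rewrite [LHS](reindex_inj (addIr x)).
rewrite big_split /= sumr_const => /esym/eqP.
by rewrite -subr_eq0 [X in X - _]addrC addrK => /eqP.
Qed.

Lemma odd_card_two_neq0 : 2%:R != 0 :> F.
Proof.
apply/eqP => two0.
have cF : #|F| = (2 * #|F|./2 + 1)%N.
  by rewrite -[LHS]odd_double_half oddF mul2n addnC.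
have /eqP := card_mulr_eq0 (1 : F).
by rewrite cF natrD natrM two0 mul0r add0r oner_eq0.
Qed.

Lemma oppr_neq (x : F) : x != 0 -> - x != x.
Proof.
move=> x0; rewrite -subr_eq0 -opprD oppr_eq0 -mulr2n -mulr_natl mulf_neq0 //.
exact: odd_card_two_neq0.
Qed.


Lemma card_scaled_sqr_le2 (c w : F) :
  c != 0 -> (#|[set v | (c * v ^+ 2 == w)%R]| <= 2)%N.
Proof.
move=> c0; case: (set_0Vmem [set v | (c * v ^+ 2 == w)%R]) => [->|[v]].
  by rewrite cards0.
rewrite inE => /eqP vw; apply: leq_trans (_ : #|[set v; - v]| <= 2)%N.
  apply: subset_leq_card; apply/subsetP => u; rewrite !inE -vw.
  by rewrite (inj_eq (mulfI c0)) eqf_sqr.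
by rewrite cards2; case: (_ != _).
Qed.

Lemma card_sqr_le2 (w : F) : (#|[set v : F | v ^+ 2 == w]| <= 2)%N.
Proof.
by have := card_scaled_sqr_le2 w (oner_neq0 F); under eq_finset do rewrite mul1r.
Qed.

(** Otherwise squaring would be a bijection of F, yet it identifies 1 and -1. *)
Lemma exists_nonsquare : exists c : F, forall v, v ^+ 2 != c.
Proof.
suff /existsP[c /forallP cP] : [exists c : F, [forall v : F, v ^+ 2 != c]].
  by exists c.
rewrite -[[exists _, _]]negbK negb_exists; apply/negP => /forallP sur.
have surj c : exists v : F, v ^+ 2 == c.
  by move: (sur c); rewrite negb_forall => /existsP[v]; rewrite negbK; exists v.
pose g c := xchoose (surj c).
have gK : cancel g (fun v => v ^+ 2) by move=> c; apply/eqP/(xchooseP (surj c)).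
have gK' := canF_sym gK.
have e1 : (-1 : F) = 1 by apply: (can_inj gK'); rewrite /= sqrrN.
by have := oppr_neq (oner_neq0 F); rewrite e1 eqxx.
Qed.

Section Twist.
Variable c : F.
Hypothesis nsqc : forall v, v ^+ 2 != c.

Lemma nonsquare_neq0 : c != 0.
Proof. by have := nsqc 0; rewrite expr0n eq_sym. Qed.

(** The left-hand side is at most 2, because a nonzero w cannot be both a square
    and c times a square; and its average over w is exactly 2.  This replaces
    all uses of the quadratic character. *)
Lemma card_sqr_twisted w :
  (#|[set v : F | v ^+ 2 == w]| + #|[set v : F | (c * v ^+ 2 == w)%R]| = 2)%N.
Proof.
have le2 u : (#|[set v : F | v ^+ 2 == u]| + #|[set v : F | (c * v ^+ 2 == u)%R]|
    <= 2)%N.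
  have [->|u0] := eqVneq u 0.
    suff eq0 b : b != 0 -> #|[set v : F | (b * v ^+ 2 == 0)%R]| = 1%N.
      rewrite (eq0 c nonsquare_neq0) addn1 ltnS.
      by have := eq0 1 (oner_neq0 _); under eq_finset do rewrite mul1r; move=> ->.
    move=> b0; rewrite -(cards1 (0 : F)); congr #|pred_of_set _|.
    by apply/setP => v; rewrite !inE mulf_eq0 (negPf b0) expf_eq0.
  case: (set_0Vmem [set v : F | v ^+ 2 == u]) => [->|[v]].
    by rewrite cards0 card_scaled_sqr_le2 ?nonsquare_neq0.
  rewrite inE => /eqP vu.
  suff -> : [set z : F | (c * z ^+ 2 == u)%R] = set0.
    by rewrite cards0 addn0 card_sqr_le2.
  apply/setP => z; rewrite !inE; apply: contraNF (nsqc (v / z)) => /eqP zu.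
  have z0 : z != 0.
    by apply: contraNneq u0 => z0; rewrite -zu z0 expr0n mulr0.
  by rewrite expr_div_n vu -zu mulfK // expf_neq0.
have card_fibers (f : F -> F) : (\sum_u #|[set v : F | f v == u]| = #|F|)%N.
  rewrite -[RHS]sum1_card [RHS](partition_big f predT) //=; apply: eq_bigr => u _.
  by rewrite -sum1_card; apply: eq_bigl => v; rewrite inE.
have tot : (\sum_u (#|[set v : F | v ^+ 2 == u]| +
    #|[set v : F | (c * v ^+ 2 == u)%R]|) = \sum_(u : F) 2)%N.
  by rewrite big_split /= !card_fibers sum_nat_const muln2 addnn.
apply/eqP; rewrite eqn_leq le2 leqNgt; apply/negP => lt2.
suff : (\sum_u (#|[set v : F | v ^+ 2 == u]| +
    #|[set v : F | (c * v ^+ 2 == u)%R]|) < \sum_(u : F) 2)%N by rewrite tot ltnn.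
rewrite (bigD1 w) //= [X in (_ < X)%N](bigD1 w) //= -addSn leq_add //.
exact: leq_sum.
Qed.

Lemma sum_sqr_twisted (phi : F -> algC) :
  \sum_v phi (v ^+ 2) + \sum_v phi (c * v ^+ 2) = 2%:R * \sum_w phi w.
Proof.
have fibers (f : F -> F) :
    \sum_v phi (f v) = \sum_w #|[set v | f v == w]|%:R * phi w.
  rewrite (partition_big f predT) //=; apply: eq_bigr => w _.
  rewrite (eq_bigr (fun=> phi w)) => [|v /eqP->//].
  rewrite sumr_const mulr_natl; congr (_ *+ _); apply: eq_card => v.
  by rewrite inE.
rewrite (fibers (fun v => v ^+ 2)) (fibers (fun v => c * v ^+ 2)) -big_split.
rewrite mulr_sumr /=; apply: eq_bigr => w _.
by rewrite -mulrDl -natrD card_sqr_twisted.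
Qed.

End Twist.
End Squares.

Section AdditiveCharacters.
Variables (V : finZmodType) (chi : V -> algC).

Definition additive_char :=
  (forall x y, chi (x + y) = chi x * chi y) /\ (forall x, `|chi x| = 1).

Hypothesis chiP : additive_char.

Lemma acharD x y : chi (x + y) = chi x * chi y. Proof. exact: chiP.1. Qed.
Lemma normr_achar x : `|chi x| = 1. Proof. exact: chiP.2. Qed.

Lemma achar_neq0 x : chi x != 0.
Proof. by rewrite -normr_gt0 normr_achar. Qed.

Lemma achar0 : chi 0 = 1.
Proof. by apply: (mulfI (achar_neq0 0)); rewrite -acharD addr0 mulr1. Qed.

Lemma acharN x : chi (- x) = (chi x)^*.
Proof.
apply: (mulfI (achar_neq0 x)); rewrite -acharD subrr achar0 -normCK.
by rewrite normr_achar expr1n.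
Qed.

Lemma acharMn x n : chi (x *+ n) = chi x ^+ n.
Proof.
by elim: n => [|n IH]; rewrite ?mulr0n ?achar0 // mulrS acharD IH exprS.
Qed.

Lemma achar_sum I (r : seq I) (P : pred I) (G : I -> V) :
  chi (\sum_(i <- r | P i) G i) = \prod_(i <- r | P i) chi (G i).
Proof. by apply: big_morph; [exact: acharD|exact: achar0]. Qed.

(** Translation by a point where chi is not 1 multiplies the sum by chi of that
    point. *)
Lemma sum_achar : (exists x, chi x != 1) -> \sum_x chi x = 0.
Proof.
move=> [x0 nt].
have : \sum_x chi x = \sum_x chi (x0 + x) by rewrite [LHS](reindex_inj (addrI x0)).
under [X in _ = X]eq_bigr do rewrite acharD.
rewrite -mulr_sumr => /eqP.
rewrite -subr_eq0 -{1}[\sum_x _]mul1r -mulrBl mulf_eq0 subr_eq0 eq_sym.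
by rewrite (negPf nt) => /eqP.
Qed.

End AdditiveCharacters.

Lemma achar_comp (U V : finZmodType) (f : U -> V) (chi : V -> algC) :
  {morph f : x y / x + y} -> additive_char chi -> additive_char (chi \o f).
Proof.
by move=> fD chiP; split=> [x y|x] /=; rewrite ?fD ?(acharD chiP) ?(normr_achar chiP).
Qed.

Section ScalarSums.
Variables (F : finFieldType) (chi : F -> algC).
Hypotheses (chiP : additive_char chi) (chi_nt : exists x, chi x != 1).

Lemma sum_achar_scale a : \sum_x chi (a * x) = (a == 0)%:R * #|F|%:R.
Proof.
have [->|a0] := eqVneq a 0.
  rewrite (eq_bigr (fun=> 1)) => [|x _]; last by rewrite mul0r (achar0 chiP).
  by rewrite sumr_const mul1r.
have [x0 nt] := chi_nt; rewrite mul0r.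
have := sum_achar (achar_comp (mulrDr a) chiP); apply.
by exists (x0 / a); rewrite /= mulrC divfK.
Qed.

End ScalarSums.

Lemma card_finField_pchar (F : finFieldType) p : p \in [pchar F] ->
  exists2 n, (0 < n)%N & #|F| = (p ^ n)%N.
Proof.
move=> pF; have /and3P[pg _ _] := fin_ring_pchar_abelem pF.
have [n] := p_natP pg; rewrite cardsT => cF; exists n => //.
by case: n cF => // cF; have := finNzRing_gt1 F; rewrite cF.
Qed.

(** chi(x) = zeta^Tr(x), with Tr(x) = sum_(i < n) x^(p^i) the absolute trace and
    zeta a primitive p-th root of unity; Tr x lies in the prime field because
    it is fixed by the Frobenius map, and it is not identically zero because
    it is a polynomial of degree less than q.  Invariance under x |-> x^p is
    what makes chi trivial on the values y^p - y. *)
Lemma absolute_trace_char (F : finFieldType) p : p \in [pchar F] ->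
  exists chi : F -> algC, [/\ additive_char chi, exists x, chi x != 1
    & forall x, chi (x ^+ p) = chi x].
Proof.
move=> pF; have p_pr := pcharf_prime pF; have p0 := prime_gt0 p_pr.
have [n n0 cF] := card_finField_pchar pF.
have pnat k : [pchar F].-nat (p ^ k)%N.
  by rewrite (eq_pnat _ (pcharf_eq pF)) pnatX pnat_id.
have z0 : (0 : F) ^+ p = 0 by rewrite expr0n gtn_eqF.
pose tr (x : F) := \sum_(i < n) x ^+ (p ^ i).
have trD : {morph tr : x y / x + y}.
  by move=> x y; rewrite -big_split; apply: eq_bigr => i _; rewrite exprDn_pchar.
have trF x : tr x ^+ p = tr x.
  rewrite (big_morph (fun y => y ^+ p) (fun y z => exprDn_pchar y z (pnat 1%N))
    z0) /tr; case: (n) n0 cF => // m _ cF.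
  rewrite [LHS]big_ord_recr [RHS]big_ord_recl /= -exprM -expnSr -cF expf_card.
  rewrite addrC expr1; congr (_ + _); apply: eq_bigr => i _.
  by rewrite -exprM -expnSr.
have trFp x : tr (x ^+ p) = tr x.
  rewrite -[RHS]trF (big_morph (fun y => y ^+ p)
    (fun y z => exprDn_pchar y z (pnat 1%N)) z0).
  by apply: eq_bigr => i _; rewrite -!exprM mulnC.
pose s := [seq k%:R : F | k <- iota 0 p].
have natr_mod i j : i%:R = j%:R :> F -> i = j %[mod p].
  wlog ij : i j / (i <= j)%N.
    by move=> W; case: (leqP i j) => [/W//|/ltnW/W ji /esym/ji].
  move=> eij; apply/esym/eqP; rewrite eqn_mod_dvd // (dvdn_pcharf pF) natrB //.
  by rewrite eij subrr.
have us : uniq s.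
  rewrite map_inj_in_uniq ?iota_uniq // => i j; rewrite !mem_iota /= => ip jp.
  by move/natr_mod; rewrite !modn_small.
(* The prime field consists of the p roots k%:R of X^p - X. *)
have mem_s y : y ^+ p = y -> y \in s.
  move=> yp; apply: contraT => ys.
  have := @max_poly_roots F ('X^p - 'X) (y :: s).
  have szX : size ('X^p - 'X : {poly F}) = p.+1.
    by rewrite size_polyDl size_polyXn // size_polyN size_polyX ltnS prime_gt1.
  rewrite szX -size_poly_eq0 szX /= size_map size_iota ltnn ys us /=.
  rewrite rootE !hornerE yp subrr eqxx /= => -> //.
  apply/allP => _ /mapP[k _ ->]; rewrite rootE !hornerE.
  by rewrite -[k%:R ^+ p]/(pFrobenius_aut pF k%:R) rmorph_nat subrr.
pose idx y := index y s.
have idxK x : (idx (tr x))%:R = tr x.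
  have ts := mem_s _ (trF x); have lt := ts; rewrite -index_mem in lt.
  rewrite -[RHS](nth_index 0 ts) (nth_map 0%N).
    by rewrite nth_iota // -[X in (_ < X)%N](size_iota 0) -(size_map (fun k => k%:R : F)).
  by rewrite -(size_map (fun k => k%:R : F)).
have [z pz] := C_prim_root_exists p0.
exists (fun x => z ^+ idx (tr x)); split; last by move=> x; rewrite trFp.
  split=> [x y|x].
    rewrite -exprD; apply/eqP; rewrite (eq_prim_root_expr pz); apply/eqP.
    by apply: natr_mod; rewrite natrD !idxK trD.
  apply/eqP; rewrite -(@pexpr_eq1 _ _ p) ?normr_ge0 //.
  by rewrite -normrX exprAC (prim_expr_order pz) expr1n normr1.
have [x trx] : exists x, tr x != 0.
  apply/existsP; rewrite -[[exists _, _]]negbK negb_exists; apply/negP => tr0.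
  pose T : {poly F} := \sum_(i < n) 'X^(p ^ i).
  have T1 : T`_(p ^ n.-1) = 1.
    rewrite coef_sum; case: (n) n0 => // m _; rewrite big_ord_recr /= coefXn eqxx.
    rewrite big1 ?add0r // => i _; rewrite coefXn eqn_exp2l ?prime_gt1 //.
    by rewrite gtn_eqF.
  have T0 : T != 0 by apply: contra_eq_neq T1 => ->; rewrite coef0 eq_sym oner_eq0.
  have szT : (size T <= p ^ n)%N.
    apply: (leq_trans (size_sum _ _ _)); apply/bigmax_leqP => i _.
    by rewrite size_polyXn ltn_exp2l ?prime_gt1.
  suff : (#|F| < size T)%N by rewrite cF ltnNge szT.
  rewrite cardT; apply: (max_poly_roots T0 _ (enum_uniq F)).
  apply/allP => x _; have := forallP tr0 x; rewrite negbK => /eqP tx.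
  rewrite rootE horner_sum; apply/eqP; rewrite -[RHS]tx.
  by apply: eq_bigr => i _; rewrite hornerXn.
exists x; apply: contra trx => /eqP zi.
by rewrite -[tr x]idxK -(dvdn_pcharf pF) (prim_order_dvd pz) zi.
Qed.

(** * Kloosterman sums over quadratic extensions *)

(** E is F(sqrt c), presented by the basis 1, w with w = sqrt c. *)
Lemma quadratic_extension (F : finFieldType) (c : F) :
  (forall v, v ^+ 2 != c) ->
  exists (E : finFieldType) (iota : {rmorphism F -> E}) (w : E),
    w ^+ 2 = iota c /\ bijective (fun z : F * F => iota z.1 + iota z.2 * w).
Proof.
move=> nsq; pose P : {poly F} := 'X^2 - c%:P.
have szP : size P = 3.
  by rewrite size_polyDl size_polyXn // size_polyN size_polyC; case: (c != 0).
have irrP : irreducible_poly P.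
  apply: cubic_irreducible; first by rewrite szP.
  by move=> x; rewrite rootE !hornerE subr_eq0 nsq.
have [L dimL [w rw _]] := irredp_FAdjoin irrP.
pose E : finFieldType := finvect_type L.
pose iota : {rmorphism F -> E} := in_alg L.
have w2 : (w : E) ^+ 2 = iota c.
  move: rw; rewrite rootE rmorphB /= map_polyXn map_polyC !hornerE subr_eq0.
  by move/eqP.
exists E, iota, w; split=> //.
apply: inj_card_bij => [[u v] [u' v'] /= eq_uv|]; last first.
  have cL : #|E| = (#|F| ^ 2)%N.
    have := card_vspacef (Vector.class (E : vectType F)).
    by rewrite card_vspace dimL szP => <-.
  by rewrite cL card_prod expnS expn1.
have [eqv|neqv] := eqVneq v v'.
  by move: eq_uv; rewrite eqv => /addIr/(fmorph_inj iota) ->.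
have /negP[] := nsq ((u' - u) / (v - v')).
have v0 : iota (v - v') != 0 by rewrite fmorph_eq0 subr_eq0.
apply/eqP/(fmorph_inj iota); rewrite rmorphXn fmorph_div -w2; congr (_ ^+ 2).
apply: (mulIf v0); rewrite divfK // !rmorphB.
apply/eqP; rewrite -subr_eq0; apply/eqP.
transitivity (iota u' + iota v' * w - (iota u + iota v * w)); first by ring.
by rewrite eq_uv subrr.
Qed.

Definition kloosterman (F : finFieldType) (chi : F -> algC) (a : F) : algC :=
  \sum_(x | x != 0) chi (x + a / x).

Definition char_pow (F : finFieldType) (chi : F -> algC) k : F -> algC :=
  fun x => chi x ^+ k.

Definition frobenius_char (F : finFieldType) p (chi : F -> algC) :=
  [/\ additive_char chi, exists x, chi x != 1 & forall x, chi (x ^+ p) = chi x].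

Lemma kloosterman_real (F : finFieldType) (chi : F -> algC) a :
  additive_char chi -> kloosterman chi a \is Num.real.
Proof.
move=> chiP; apply/CrealP; rewrite /kloosterman rmorph_sum /=.
rewrite (reindex_inj oppr_inj) /=; apply: eq_big => x; rewrite oppr_eq0 // => _.
by rewrite -(acharN chiP) invrN mulrN -opprD opprK.
Qed.

Lemma additive_char_pow (F : finFieldType) (chi : F -> algC) k :
  additive_char chi -> additive_char (char_pow chi k).
Proof.
move=> chiP; split=> [x y|x]; rewrite /char_pow.
  by rewrite (acharD chiP) exprMn.
by rewrite normrX (normr_achar chiP) expr1n.
Qed.

Lemma char_pow_nontrivial (F : finFieldType) p (chi : F -> algC) k :
  p \in [pchar F] -> additive_char chi -> (exists x, chi x != 1) ->
  ~~ (p %| k)%N -> exists x, char_pow chi k x != 1.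
Proof.
move=> pF chiP [x nt] pk; exists (x / k%:R); rewrite /char_pow -(acharMn chiP).
by rewrite -[_ *+ k]mulr_natr divfK // -(dvdn_pcharf pF).
Qed.

Section Doubling.
Variables (F E : finFieldType) (iota : {rmorphism F -> E}) (c : F) (w : E).
Hypotheses (oddF : odd #|F|) (nsqc : forall v, v ^+ 2 != c).
Hypothesis w2 : w ^+ 2 = iota c.
Let pr (z : F * F) := iota z.1 + iota z.2 * w.
Hypothesis bij_pr : bijective pr.

(** Both sums are over pairs (u, v): a unit of E is u + v w, with norm
    u^2 - c v^2 and trace 2 u, while a pair of units of F is (u + v, u - v),
    with product u^2 - v^2 and sum 2 u.  In both cases the summand depends on v
    only through c v^2, respectively v^2.  As each element of F is attained
    exactly twice by v^2 and c v^2 together, the two sums add up to twice the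
    sum over u and n <> 0 of chi(2 u (1 + a / n)), in which only n = - a
    survives. *)
Lemma kloosterman_double (chi : F -> algC) (chi' : E -> algC) (a : F) :
  additive_char chi -> (exists x, chi x != 1) ->
  (forall u v, chi' (iota u + iota v * w) = chi (2%:R * u)) -> a != 0 ->
  kloosterman chi' (iota a) = 2%:R * #|F|%:R - kloosterman chi a ^+ 2.
Proof.
move=> chiP nt chi'E a0; have two0 := odd_card_two_neq0 oddF.
have c0 := nonsquare_neq0 nsqc.
pose Phi u W : algC := if W == u ^+ 2 then 0
  else chi (2%:R * u + 2%:R * a * u / (u ^+ 2 - W)).
have KE : kloosterman chi' (iota a) = \sum_u \sum_v Phi u (c * v ^+ 2).
  rewrite /kloosterman big_mkcond pair_big /= (reindex pr) /=; last first.
    exact: onW_bij.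
  apply: eq_bigr => [[u v]] _ /=; rewrite /Phi /pr /=.
  have key : (c * v ^+ 2 == u ^+ 2) = (iota u + iota v * w == 0).
    have [->|v0] := eqVneq v 0.
      rewrite expr0n mulr0 rmorph0 mul0r addr0 fmorph_eq0 eq_sym.
      by rewrite expf_eq0.
    have -> : (c * v ^+ 2 == u ^+ 2) = false.
      apply: contraNF (nsqc (u / v)) => /eqP eq_uv.
      by rewrite expr_div_n -eq_uv mulfK // expf_neq0.
    apply/esym/negP => /eqP eq0.
    have : pr (u, v) = pr (0, 0) by rewrite /pr /= eq0 !rmorph0 mul0r addr0.
    by move/(bij_inj bij_pr) => [_ v00]; rewrite v00 eqxx in v0.
  rewrite key; case: eqP => //= /eqP nz.
  have nz' : u ^+ 2 - c * v ^+ 2 != 0 by rewrite subr_eq0 eq_sym key.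
  set n := u ^+ 2 - c * v ^+ 2 in nz' *.
  have defV : (iota u + iota v * w)^-1 = iota (u / n) + iota (- v / n) * w.
    apply: (mulfI nz); rewrite mulfV // -[1](rmorph1 iota) -(mulfV nz') /n.
    rewrite !fmorph_div rmorphN rmorphB rmorphXn rmorphM rmorphXn -w2.
    field; rewrite exprMn w2 -!(rmorphXn iota) -rmorphM.
    by rewrite -rmorphB fmorph_eq0.
  have -> : iota u + iota v * w + iota a / (iota u + iota v * w) =
      iota (u + a * (u / n)) + iota (v + a * (- v / n)) * w.
    by rewrite defV !rmorphD !rmorphM; ring.
  by rewrite chi'E; congr (chi _); ring.
have KF : kloosterman chi a ^+ 2 = \sum_u \sum_v Phi u (v ^+ 2).
  pose f (z : F * F) := (z.1 + z.2, z.1 - z.2).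
  have f_bij : bijective f.
    exists (fun z : F * F => ((z.1 + z.2) / 2%:R, (z.1 - z.2) / 2%:R)) => [[x y]|[x y]] /=;
      by congr (_, _); rewrite /=; field.
  rewrite /kloosterman expr2 big_distrlr /= big_mkcond /=.
  rewrite (eq_bigr (fun x => \sum_y if (x == 0) || (y == 0) then 0 else
      chi (x + a / x) * chi (y + a / y))) => [|x _]; last first.
    case: eqP => _ /=; first by rewrite big1.
    by rewrite big_mkcond; apply: eq_bigr => y _; case: eqP.
  rewrite pair_big /= (reindex f) /=; last exact: onW_bij.
  rewrite pair_big /=; apply: eq_bigr => [[u v]] _ /=; rewrite /Phi /f /=.
  have -> : (v ^+ 2 == u ^+ 2) = (u + v == 0) || (u - v == 0).
    by rewrite eq_sym eqf_sqr subr_eq0 addr_eq0 orbC.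
  case: ifP => // /negbT; rewrite negb_or => /andP[nz1 nz2].
  rewrite -(acharD chiP); congr (chi _); field.
  by rewrite nz1 nz2 subr_sqr mulf_neq0.
suff tot : \sum_u \sum_v Phi u (v ^+ 2) + \sum_u \sum_v Phi u (c * v ^+ 2)
    = 2%:R * #|F|%:R by rewrite KE KF -tot addrC addKr.
rewrite -big_split /=.
under eq_bigr => u _ do rewrite (sum_sqr_twisted nsqc).
rewrite -mulr_sumr; congr (_ * _).
have step u : \sum_W Phi u W =
    \sum_(n | n != 0) chi (2%:R * (1 + a / n) * u).
  rewrite (reindex_inj (inj_comp (addrI (u ^+ 2)) oppr_inj)) /= [RHS]big_mkcond.
  apply: eq_bigr => n _; rewrite /Phi -subr_eq0 addrAC subrr add0r oppr_eq0.
  case: eqP => //= _; rewrite opprD opprK addrA subrr add0r.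
  by congr (chi _); ring.
under eq_bigr => u _ do rewrite step.
rewrite exchange_big /= (bigD1 (- a)) ?oppr_eq0 //= [X in _ + X]big1 => [|n /andP[n0 na]].
  rewrite invrN mulrN divff // subrr mulr0 addr0.
  by rewrite (sum_achar_scale chiP nt) eqxx mul1r.
rewrite (sum_achar_scale chiP nt) mulf_eq0 (negPf two0) /=.
suff -> : (1 + a / n == 0) = false by rewrite mul0r.
apply: contraNF na; rewrite addrC addr_eq0 => /eqP an.
by rewrite -[a](divfK n0) an mulN1r opprK.
Qed.

End Doubling.

(** * Towers of quadratic extensions and Artin-Schreier curves *)

(** The lift is chi composed with the trace of E over F, that is
    u + v w |-> chi(2 u); it is again invariant under the Frobenius map, since
    w^p is a multiple of w by an element of F. *)
Lemma quadratic_lift (F : finFieldType) p (chi : F -> algC) :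
  p \in [pchar F] -> odd #|F| -> frobenius_char p chi ->
  exists (E : finFieldType) (iota : {rmorphism F -> E}) (chi' : E -> algC),
    [/\ p \in [pchar E], #|E| = (#|F| ^ 2)%N, frobenius_char p chi'
      & forall k a, ~~ (p %| k)%N -> a != 0 ->
        kloosterman (char_pow chi' k) (iota a)
          = 2%:R * #|F|%:R - kloosterman (char_pow chi k) a ^+ 2].
Proof.
move=> pF oddF [chiP nt frob]; have two0 := odd_card_two_neq0 oddF.
have [c nsqc] := exists_nonsquare oddF.
have [E [iota [w [w2 bij_pr]]]] := quadratic_extension nsqc.
have pE : p \in [pchar E] by rewrite (rmorph_pchar iota).
have [g gK Kg] := bij_pr.
pose chi' z := chi (2%:R * (g z).1).
have chi'E u v : chi' (iota u + iota v * w) = chi (2%:R * u).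
  by rewrite /chi' -[iota u + _]/((fun z => iota z.1 + iota z.2 * w) (u, v)) gK.
have zE z : z = iota (g z).1 + iota (g z).2 * w by rewrite -[LHS]Kg.
have p_odd : odd p.
  apply: contraTT two0 => /negbTE ep; rewrite negbK -(dvdn_pcharf pF).
  by have := even_prime (pcharf_prime pF); rewrite ep => -[->|].
(* The Frobenius map preserves the lines F and F w. *)
have wp : w ^+ p = iota (c ^+ p./2) * w.
  by rewrite -[p in LHS]odd_double_half p_odd exprS mulrC -mul2n exprM w2 rmorphXn.
exists E, iota, chi'; split=> //.
- by rewrite -(bij_eq_card bij_pr) card_prod expnS expn1.
- split.
  + split=> [x y|x]; last exact: (normr_achar chiP).
    rewrite (zE x) (zE y) addrACA -mulrDl -!rmorphD !chi'E mulrDr.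
    exact: (acharD chiP).
  + have [x0 nt0] := nt; exists (iota (x0 / 2%:R) + iota 0 * w).
    by rewrite chi'E mulrC divfK.
  + move=> z; rewrite (zE z) exprDn_pchar; last first.
      by rewrite (eq_pnat _ (pcharf_eq pE)) pnat_id ?(pcharf_prime pF).
    rewrite exprMn wp mulrA -!(rmorphXn iota) -rmorphM !chi'E.
    rewrite -[RHS]frob exprMn; congr (chi (_ * _)).
    by rewrite -/(pFrobenius_aut pF 2%:R) rmorph_nat.
move=> k a pk a0; apply: (kloosterman_double oddF nsqc w2 bij_pr) => //.
- exact: additive_char_pow.
- exact: char_pow_nontrivial pF _ _ _.
- by move=> u v; rewrite /char_pow chi'E.
Qed.

(** The value obtained from x by j applications of the doubling formula, starting
    from a field with Q elements. *)
Fixpoint kdouble j (Q : nat) (x : algC) : algC :=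
  if j is j'.+1 then 2%:R * (Q ^ (2 ^ j'))%:R - kdouble j' Q x ^+ 2 else x.

Lemma kloosterman_tower (F : finFieldType) p (chi : F -> algC) a j :
  p \in [pchar F] -> odd #|F| -> frobenius_char p chi -> a != 0 ->
  exists (E : finFieldType) (chi' : E -> algC) (a' : E),
    [/\ p \in [pchar E], #|E| = (#|F| ^ (2 ^ j))%N, frobenius_char p chi', a' != 0
      & forall k, ~~ (p %| k)%N ->
        kloosterman (char_pow chi' k) a'
          = kdouble j #|F| (kloosterman (char_pow chi k) a)].
Proof.
move=> pF oddF chiP a0; elim: j => [|j [E [chi' [a' [pE cE chi'P a'0 kE]]]]].
  by exists F, chi, a; split; rewrite // expn0 expn1.
have oddE : odd #|E| by rewrite cE oddX oddF orbT.
have [E2 [iota [chi2 [pE2 cE2 chi2P kE2]]]] := quadratic_lift pE oddE chi'P.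
exists E2, chi2, (iota a'); split; rewrite ?fmorph_eq0 //.
  by rewrite cE2 cE -expnM expnSr.
by move=> k pk; rewrite kE2 // kE // cE.
Qed.

(** As chi(y^p - y) = 1, the sum of chi(u)^k over all k < p is at least the number
    of y with y^p - y = u.  Hence the sum of all p Kloosterman sums, k = 0
    included, is at least the number of points on y^p - y = x + a / x.  For a
    given y this is a quadratic equation in x with discriminant
    f(y) = (y^p - y)^2 - 4 a, so it has two solutions unless f(y) is zero or a
    nonsquare, and Stepanov's method shows that f(y) is a nonsquare for at most
    r^2 / 2 + O(p r) values of y. *)
Lemma artin_schreier_count (E : finFieldType) p s (chi : E -> algC) a :
  let r := s.*2.+1 in
  p \in [pchar E] -> p.-nat r -> #|E| = (r * r)%N -> frobenius_char p chi ->
  a != 0 -> (p <= s)%N ->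
  - (6 * p * r)%:R <= \sum_(1 <= k < p) kloosterman (char_pow chi k) a.
Proof.
move=> r pE pr cE [chiP nt frob] a0 ps; have p_pr := pcharf_prime pE.
have arith t : ((2 * (t * t.*2.+2)).+1 = t.*2.+1 * t.*2.+1)%N by clear; nia.
have oddE : odd #|E| by rewrite cE oddM /r /= odd_double.
have two0 := odd_card_two_neq0 oddE.
have four0 : 4%:R != 0 :> E by rewrite (natrM _ 2 2) mulf_neq0.
pose f : {poly E} := ('X^p - 'X) ^+ 2 - (4%:R * a)%:P.
have fE y : f.[y] = (y ^+ p - y) ^+ 2 - 4%:R * a by rewrite /f !hornerE.
have szf : size f = p.*2.+1.
  have szX : size ('X^p - 'X : {poly E}) = p.+1.
    by rewrite size_polyDl size_polyXn // size_polyN size_polyX ltnS prime_gt1.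
  have sz2 : size (('X^p - 'X : {poly E}) ^+ 2) = p.*2.+1.
    by rewrite expr2 size_mul -?size_poly_eq0 szX // addSn addnS addnn.
  rewrite size_polyDl sz2 // size_polyN size_polyC; case: (_ != _) => //.
  by rewrite ltnS double_gt0 prime_gt0.
have f0 : f.[0] != 0.
  rewrite fE expr0n gtn_eqF ?prime_gt0 // subrr expr0n sub0r oppr_eq0.
  by rewrite mulf_neq0.
have f' : f^`() = - ('X^p - 'X) *+ 2.
  rewrite derivB derivC subr0 deriv_exp derivB derivXn derivX.
  by rewrite -[_ *+ p]mulr_natr -polyC_natr pcharf0 // mulr0 sub0r mulN1r.
have sepf : separable_poly f.
  rewrite unlock; apply/Bezout_coprimepP.
  have half : (2%:R^-1 : E)%:P *+ 2 = 1 by rewrite -polyCMn -[_ *+ 2]mulr_natr mulVf.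
  exists (1, (2%:R^-1)%:P * ('X^p - 'X)); rewrite f' /f /=.
  move: ('X^p - 'X) => W.
  have -> : 1 * (W ^+ 2 - (4%:R * a)%:P) + 2%:R^-1%:P * W * (- W *+ 2) =
      - (4%:R * a)%:P + W ^+ 2 * (1 - 2%:R^-1%:P *+ 2) by ring.
  by rewrite half subrr mulr0 addr0 -polyCN polyC_eqp1 oppr_eq0 mulf_neq0.
have [c nsqc] := exists_nonsquare oddE; have c0 := nonsquare_neq0 nsqc.
pose isq y := [exists v, v ^+ 2 == f.[y]].
have nonsq_le : (#|[set y | ~~ isq y]| <= r * (s + p.*2))%N.
  have cs0 : c ^+ (s * r.+1) != 0 by rewrite expf_neq0.
  have bnd := stepanov pE pr cE szf f0 sepf.
  rewrite prime_gt0 // in bnd; apply: leq_trans (bnd _ ps cs0).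
  apply: subset_leq_card; apply/subsetP => y; rewrite !inE => nsq.
  have := card_sqr_twisted nsqc f.[y].
  rewrite (_ : [set v | v ^+ 2 == _] = set0) ?cards0; last first.
    apply/setP => v; rewrite !inE; apply: contraNF nsq => v2.
    by apply/existsP; exists v.
  rewrite add0n => card2.
  have /set0Pn[v] : [set v | (c * v ^+ 2 == f.[y])%R] != set0.
    by rewrite -cards_eq0 card2.
  rewrite inE => /eqP fy; have v0 : v != 0.
    apply: contraNneq nsq => v0; apply/existsP; exists 0.
    by rewrite -fy v0 expr0n mulr0.
  (* A nonsquare is c v^2, and v^(2 s (r + 1)) = v^(Q - 1) = 1. *)
  rewrite -fy exprMn -exprM -{2}[c ^+ _]mulr1; apply/eqP; congr (_ * _).
  apply: (mulIf v0); rewrite mul1r -exprSr -[RHS]expf_card cE; congr (_ ^+ _).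
  by rewrite -arith.
pose zr := [set y : E | root f y].
have zr_le : (#|zr| <= p.*2)%N.
  have fn0 : f != 0 by rewrite -size_poly_eq0 szf.
  rewrite -ltnS -szf cardE; apply: max_poly_roots fn0 _ (enum_uniq _).
  by apply/allP => y; rewrite mem_enum inE.
pose N y := #|[set x : E | (x != 0) && (x + a / x == y ^+ p - y)]|.
have N_ge y : isq y -> y \notin zr -> (2 <= N y)%N.
  case/existsP => v /eqP; rewrite fE inE rootE fE => v2 nz.
  have v0 : v != 0.
    by apply: contraNneq nz => v0; rewrite -v2 v0 expr0n.
  set u := y ^+ p - y in v2 *.
  have solves (e : E) : e ^+ 2 = v ^+ 2 ->
      (u + e) / 2%:R \in [set x : E | (x != 0) && (x + a / x == y ^+ p - y)].
    move=> e2; rewrite inE -/u.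
    have prod : (u + e) / 2%:R * ((u - e) / 2%:R) = a.
      rewrite mulrACA [X in X * _]mulrC -subr_sqr e2 v2 opprB addrC addrNK.
      by rewrite -invfM -natrM mulrAC divff // mul1r.
    have nz' : (u + e) / 2%:R != 0.
      by apply: contraNneq a0 => e0; rewrite -prod e0 mul0r.
    by rewrite nz' /= -prod mulrAC divff // mul1r; apply/eqP; field.
  apply: leq_trans (_ : #|[set (u + v) / 2%:R; (u - v) / 2%:R]| <= _)%N.
    rewrite cards2; case: eqVneq => // /(divIf two0)/addrI/esym/eqP.
    by rewrite (negPf (oppr_neq oddE v0)).
  apply: subset_leq_card; apply/subsetP => x; rewrite in_set2.
  by case/orP => /eqP ->; apply: solves; rewrite ?sqrrN.
(* Each y counts for 2 on the left, and is paid for by two solutions unless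
   it is one of the exceptional values. *)
have sumN : (2 * (r * r) <= \sum_y N y + 2 * (r * (s + p.*2)) + 2 * p.*2)%N.
  have -> : (2 * (r * r) = \sum_(y : E) 2)%N by rewrite sum_nat_const cE mulnC.
  apply: leq_trans (_ : \sum_y (N y + 2 * ~~ isq y + 2 * (y \in zr)) <= _)%N.
    apply: leq_sum => y _; case: (boolP (isq y)) => [sq|_]; last first.
      by rewrite muln1 -addnA addnCA leq_addr.
    case: (boolP (y \in zr)) => [_|nz]; first by rewrite muln1 leq_addl.
    by rewrite !muln0 !addn0 N_ge.
  have sum_ind (b : pred E) : (\sum_y 2 * b y = 2 * #|[set y | b y]|)%N.
    rewrite -sum1dep_card big_distrr /= [RHS]big_mkcond; apply: eq_bigr => y _.
    by case: (b y).
  rewrite 2!big_split /=.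
  have /= -> := sum_ind (fun y => ~~ isq y); have /= -> := sum_ind (fun y => y \in zr).
  apply: leq_add; [apply: leq_add => // | ]; rewrite leq_mul2l //=.
  by rewrite (_ : [set y | y \in zr] = zr) //; apply/setP => y; rewrite inE.
have fib u : #|[set y | (y ^+ p - y == u)%R]|%:R <= \sum_(k < p) chi u ^+ k.
  have chi_p : chi u ^+ p = 1.
    by rewrite -(acharMn chiP) -mulr_natr pcharf0 // mulr0 (achar0 chiP).
  have [c1|c1] := eqVneq (chi u) 1.
    rewrite (eq_bigr (fun=> 1)) => [|k _]; last by rewrite c1 expr1n.
    rewrite sumr_const card_ord ler_nat.
    have szX : size ('X^p - ('X + u%:P) : {poly E}) = p.+1.
      by rewrite size_polyDl size_polyXn // size_polyN size_XaddC ltnS prime_gt1.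
    rewrite -ltnS -szX cardE; apply: max_poly_roots (enum_uniq _).
      by rewrite -size_poly_eq0 szX.
    apply/allP => y; rewrite mem_enum inE rootE !hornerE => /eqP <-.
    by rewrite addrCA subrr addr0 subrr.
  have -> : \sum_(k < p) chi u ^+ k = 0.
    apply/eqP; rewrite -(mulrI_eq0 _ (mulfI (_ : chi u - 1 != 0))) ?subr_eq0 //.
    by rewrite -subrX1 chi_p subrr.
  rewrite (_ : [set y | _] = set0) ?cards0 //; apply/setP => y; rewrite !inE.
  apply: contraNF c1 => /eqP <-.
  by rewrite (acharD chiP) frob (acharN chiP) -normCK (normr_achar chiP) expr1n.
have le1 : (\sum_y N y)%:R <= \sum_(k < p) kloosterman (char_pow chi k) a.
  rewrite /kloosterman exchange_big /=.
  have -> : (\sum_y N y = \sum_(x : E | x != 0%R) #|[set y | (y ^+ p - y == x + a / x)%R]|)%N.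
    rewrite /N; under eq_bigr => y _ do rewrite -sum1dep_card big_mkcondr /=.
    rewrite exchange_big /=; apply: eq_bigr => x _.
    by rewrite -big_mkcond -sum1dep_card; apply: eq_bigl => y; rewrite eq_sym.
  by rewrite natr_sum; apply: ler_sum => x _; apply: fib.
have k0 : kloosterman (char_pow chi 0) a = (r * r)%:R - 1.
  rewrite /kloosterman (eq_bigr (fun=> 1)) => [|x _]; last by rewrite /char_pow expr0.
  rewrite sumr_const -cE (cardD1 (0 : E) E) natrD addrAC subrr add0r.
  by congr (_ *+ _); apply: eq_card => x; rewrite !inE andbT.
rewrite -(big_mkord predT (fun k => kloosterman (char_pow chi k) a)) in le1.
rewrite big_ltn ?prime_gt0 // k0 in le1.
have tot : (r * r <= \sum_y N y + 1 + 6 * p * r)%N.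
  move: sumN (prime_gt0 p_pr); move: (\sum_y N y)%N => S; rewrite /r.
  by clear; nia.
move: le1; rewrite -(ler_nat algC) !natrD in tot *; set S := \sum_(1 <= k < p) _.
move=> le1; have := le_trans tot (lerD (lerD le1 (lexx 1)) (lexx _)).
rewrite -subr_ge0 -[- _ <= S]subr_ge0 opprK => ge0; rewrite (le_trans ge0) //.
by rewrite le_eqVlt; apply/orP; left; apply/eqP; ring.
Qed.

(** * Weil's bound for Kloosterman sums *)

(** If t = 2 + d with d > 0, the j-th iterate is at least 2 + (j + 1) d. *)
Lemma real_iter_sqr_sub2_le2 (t : algC) (B : nat) : t \is Num.real ->
  (forall j, iter j.+1 (fun x => x ^+ 2 - 2%:R) t <= B%:R) -> t <= 2%:R.
Proof.
move=> tR bnd; rewrite real_leNgt ?realn //; apply/negP => t2.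
set d := t - 2%:R; have d0 : 0 < d by rewrite subr_gt0.
have grow j : 2%:R + j.+1%:R * d <= iter j (fun x => x ^+ 2 - 2%:R) t.
  elim: j => [|j IH] /=; first by rewrite mul1r addrCA subrr addr0.
  have jd : 0 <= j.+1%:R * d by rewrite mulr_ge0 ?ler0n // ltW.
  apply: (@le_trans _ _ ((2%:R + j.+1%:R * d) ^+ 2 - 2%:R)); last first.
    by rewrite lerB // lerXn2r // nnegrE ?addr_ge0 ?ler0n // (le_trans _ IH) ?addr_ge0 ?ler0n.
  rewrite -subr_ge0; set u := j.+1%:R * d in jd *.
  have -> : (2%:R + u) ^+ 2 - 2%:R - (2%:R + j.+2%:R * d) = u ^+ 2 + 3%:R * u - d.
    by rewrite /u -[j.+2]addn1 natrD; ring.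
  rewrite -addrA addr_ge0 ?exprn_ge0 // subr_ge0 /u mulrA -natrM.
  by apply: ler_peMl; [exact: ltW|rewrite ler1n].
have Bd : 0 <= B%:R / d by rewrite divr_ge0 ?ler0n // ltW.
have := archi_boundP Bd; set M := Num.bound _ => BM.
have := le_trans (grow M.+1) (bnd M); apply/negP; rewrite -real_ltNge ?realn //; last first.
  by rewrite ger0_real // addr_ge0 ?ler0n // mulr_ge0 ?ler0n // ltW.
rewrite ltr_pdivrMr // in BM; apply: (lt_trans BM).
by rewrite ltr_wpDl ?ler0n // ltr_pM2r // ltr_nat.
Qed.

Lemma kdouble_real j Q x : x \is Num.real -> kdouble j Q x \is Num.real.
Proof.
move=> xR; elim: j => //= j IH; rewrite rpredB ?rpredX //.
by rewrite rpredM ?realn.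
Qed.

(** With K_j(k) the sum attached to chi^k over the field with r_j = q^(2^j)
    elements, doubling gives K_(j+1)(k) <= 2 r_j for every k, and the lower
    bound for the sum of K_(j+2)(k) over 0 < k < p then yields
    K_(j+2)(1) >= - 8 p r_(j+1).  So the iterates t_j = - K_(j+1)(1) / r_j of
    t |-> t^2 - 2 are bounded, whence t_0 = (K^2 - 2 q) / q <= 2. *)
Theorem kloosterman_bound (F : finFieldType) p (chi : F -> algC) a :
  p \in [pchar F] -> odd #|F| -> frobenius_char p chi -> a != 0 ->
  kloosterman chi a ^+ 2 <= (4 * #|F|)%:R.
Proof.
move=> pF oddF chiP a0; have [chiA nt _] := chiP; have p_pr := pcharf_prime pF.
have [n n0 cF] := card_finField_pchar pF.
set q := #|F| in oddF cF *.
have q0 : (0 < q)%N by case: (q) oddF.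
have podd : odd p by move: oddF; rewrite cF oddX gtn_eqF.
have p3 : (2 < p)%N by rewrite odd_prime_gt2.
have pq : (p <= q)%N by rewrite cF -{1}[p]expn1 leq_exp2l ?prime_gt1.
pose K k := kloosterman (char_pow chi k) a.
have K1 : K 1%N = kloosterman chi a.
  by apply: eq_bigr => x _; rewrite /char_pow expr1.
have KR k : K k \is Num.real by apply/kloosterman_real/additive_char_pow.
pose y j k := kdouble j q (K k); pose r j := (q ^ (2 ^ j))%N.
have rS j : r j.+1 = (r j * r j)%N by rewrite /r expnSr expnM mulnn.
have r0 j : 0 < (r j)%:R :> algC by rewrite ltr0n expn_gt0 q0.
have yR j k : y j k \is Num.real by exact: kdouble_real.
have yS j k : y j.+1 k = 2%:R * (r j)%:R - y j k ^+ 2 by [].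
have y_le j k : y j.+1 k <= 2%:R * (r j)%:R.
  by rewrite yS gerBl -realEsqr.
have y_ge j : - (8 * p * r j.+1)%:R <= y j.+2 1%N.
  have [E [chi' [a' [pE cE chi'P a'0 kE]]]] := kloosterman_tower j.+2 pF oddF chiP a0.
  have odr : odd (r j.+1) by rewrite /r oddX oddF orbT.
  have rE : r j.+1 = (r j.+1)./2.*2.+1 by rewrite -[LHS]odd_double_half odr.
  have cE' : #|E| = ((r j.+1)./2.*2.+1 * (r j.+1)./2.*2.+1)%N.
    by rewrite -rE -rS cE.
  have prr : p.-nat (r j.+1)./2.*2.+1.
    by rewrite -rE /r cF !pnatX pnat_id.
  have ps : (p <= (r j.+1)./2)%N.
    (* This is why the tower is used only from its second step on. *)
    have : (p * p <= r j.+1)%N.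
      apply: leq_trans (leq_mul pq pq) _.
      by rewrite mulnn /r leq_pexp2l // expnS leq_pmulr // expn_gt0.
    rewrite {1}rE; move: (_./2) p3; clear; nia.
  have := artin_schreier_count pE prr cE' chi'P a'0 ps.
  rewrite -rE (eq_big_nat _ _ (F2 := y j.+2)) => [|k /andP[k0 kp]]; last first.
    by rewrite kE // gtnNdvd.
  rewrite big_ltn ?prime_gt1 // => le1.
  have le2 : \sum_(2 <= k < p) y j.+2 k <= (2 * p * r j.+1)%:R.
    apply: (@le_trans _ _ (\sum_(2 <= k < p) 2%:R * (r j.+1)%:R)).
      by apply: ler_sum => k _; exact: y_le.
    rewrite sumr_const_nat -[_ *+ (p - 2)]mulr_natr -!natrM ler_nat -!mulnA leq_mul2l /=.
    by rewrite mulnC leq_mul2r leq_subr orbT.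
  have := lerB le1 le2; rewrite addrK; apply: le_trans.
  by rewrite le_eqVlt; apply/orP; left; apply/eqP; ring.
pose t j := - y j.+1 1%N / (r j)%:R.
have tR j : t j \is Num.real by rewrite rpred_div ?rpredN ?realn.
have tS j : t j.+1 = t j ^+ 2 - 2%:R.
  rewrite /t yS rS natrM; have := lt0r_neq0 (r0 j); set R := (r j)%:R => R0.
  by field.
have t_iter j : iter j (fun x => x ^+ 2 - 2%:R) (t 0%N) = t j.
  by elim: j => //= j ->.
have : t 0%N <= 2%:R.
  apply: (real_iter_sqr_sub2_le2 (B := 8 * p)) => // j.
  by rewrite t_iter /t ler_pdivrMr // lerNl -natrM y_ge.
rewrite /t ler_pdivrMr // yS /y /= K1 /r expn0 expn1 opprB lerBlDr.
by rewrite -mulrDl -!natrD -natrM.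
Qed.

(** * Gauss sums, Salie sums and the standard bilinear form *)

Section GaussSums.
Variables (F : finFieldType) (chi : F -> algC).
Hypotheses (oddF : odd #|F|) (chiP : additive_char chi).
Hypothesis nt : exists x, chi x != 1.
Let q : algC := #|F|%:R.
Let two0 : 2%:R != 0 :> F := odd_card_two_neq0 oddF.

Definition gauss s : algC := \sum_x chi (s * x ^+ 2).

Lemma card_field_gt0 : 0 < q.
Proof. by rewrite ltr0n -[#|F|]prednK // (cardD1 0) inE. Qed.

Lemma gauss_conj s : (gauss s)^* = gauss (- s).
Proof.
rewrite /gauss rmorph_sum /=; apply: eq_bigr => x _.
by rewrite -(acharN chiP) mulNr.
Qed.

(** Expand the product and substitute x = y + u: the sum over y of chi(2 s u y)
    vanishes unless u = 0. *)
Lemma gaussN_mul s : s != 0 -> gauss s * gauss (- s) = q.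
Proof.
move=> s0; rewrite /gauss big_distrr /=.
under eq_bigr => y _.
  rewrite big_distrl (reindex_inj (addrI y)) /=.
  under eq_bigr => u _.
    rewrite -(acharD chiP).
    have -> : s * (y + u) ^+ 2 + - s * y ^+ 2 = s * u ^+ 2 + 2%:R * s * u * y by ring.
    rewrite (acharD chiP); over.
  over.
rewrite exchange_big /=.
under eq_bigr => u _ do rewrite -mulr_sumr (sum_achar_scale chiP nt).
rewrite (bigD1 0) //= big1 => [|u u0].
  by rewrite expr0n !mulr0 (achar0 chiP) eqxx !mul1r addr0.
by rewrite !mulf_eq0 (negPf two0) (negPf s0) (negPf u0) mul0r mulr0.
Qed.

Lemma gauss_normK s : s != 0 -> `|gauss s| ^+ 2 = q.
Proof. by move=> s0; rewrite normCK gauss_conj gaussN_mul. Qed.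

(** The sign e is the quadratic character of c; it does not depend on s, which
    is the point. *)
Lemma gauss_scale c : c != 0 ->
  exists2 e : algC, e ^+ 2 = 1 & forall s, s != 0 -> gauss (c * s) = e * gauss s.
Proof.
move=> c0; case: (boolP [exists b : F, b ^+ 2 == c]) => [/existsP[b /eqP bc]|].
  exists 1; first by rewrite expr1n.
  move=> s s0; have b0 : b != 0 by apply: contraNneq c0 => b0; rewrite -bc b0 expr0n.
  rewrite mul1r /gauss [RHS](reindex_inj (mulfI b0)); apply: eq_bigr => x _.
  by rewrite -bc; congr (chi _); ring.
rewrite negb_exists => /forallP nsq; exists (- 1); first by rewrite sqrrN expr1n.
move=> s s0; have /= := sum_sqr_twisted nsq (fun w => chi (s * w)).
rewrite (sum_achar_scale chiP nt) (negPf s0) mul0r mulr0 => /eqP.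
rewrite addrC addr_eq0 mulN1r => /eqP <-; apply: eq_bigr => x _.
by congr (chi _); ring.
Qed.

Lemma gauss_sqr : exists2 e : algC, e ^+ 2 = 1 &
  forall s, s != 0 -> gauss s ^+ 2 = e * q.
Proof.
have [|e e2 eG] := @gauss_scale (-1); first by rewrite oppr_eq0 oner_eq0.
exists e => // s s0; rewrite -(gaussN_mul s0) -mulN1r eG //.
by rewrite -[LHS]mul1r -e2; ring.
Qed.

Lemma gauss_sqr_nonsquare s : (forall v : F, v ^+ 2 != -1) -> s != 0 ->
  gauss s ^+ 2 = - q.
Proof.
move=> nsq s0; rewrite -(gaussN_mul s0).
have /= := sum_sqr_twisted nsq (fun w => chi (s * w)).
rewrite (sum_achar_scale chiP nt) (negPf s0) mul0r mulr0 => /eqP.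
rewrite addrC addr_eq0 => /eqP h; have -> : gauss (- s) = - gauss s.
  by rewrite -h; apply: eq_bigr => x _; rewrite mulN1r mulrN mulNr.
by rewrite mulrN opprK expr2.
Qed.

(** For b <> 0, completing the square in v - s v^2 / (4 b) replaces
    gauss(s) chi(b / s), up to a sign independent of s, by a sum over v; the sum
    over s then becomes explicit, and leaves q times the sum of chi(v) over
    v^2 = 4 a b. *)
Lemma salie_bound a b :
  `|\sum_(s | s != 0) gauss s * chi (a * s + b / s)| <= 2%:R * q.
Proof.
have q0 := card_field_gt0.
have sum_ne0 u : \sum_(s | s != 0) chi (s * u) = (u == 0)%:R * q - 1.
  rewrite -(sum_achar_scale chiP nt) [X in _ = X - 1](bigD1 0) //= mulr0 (achar0 chiP).
  by rewrite addrAC subrr add0r; apply: eq_bigr => s _; rewrite mulrC.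
have [->|b0] := eqVneq b 0.
  have -> : \sum_(s | s != 0) gauss s * chi (a * s + 0 / s) =
      \sum_x ((x ^+ 2 + a == 0)%:R * q - 1).
    under eq_bigr => s _ do rewrite mul0r addr0 /gauss mulr_suml.
    rewrite exchange_big /=; apply: eq_bigr => x _; rewrite -sum_ne0.
    by apply: eq_bigr => s _; rewrite -(acharD chiP) mulrDr [a * s]mulrC.
  rewrite sumrB sumr_const -mulr_suml -natr_sum -/q.
  set n := (\sum_x _)%N; have n2 : (n <= 2)%N.
    apply: leq_trans (card_sqr_le2 (- a)); rewrite /n -sum1dep_card [leqRHS]big_mkcond /=.
    by apply: leq_sum => x _; rewrite addr_eq0; case: eqP.
  rewrite -{2}[q]mul1r -mulrBl normrM (gtr0_norm q0) ler_pM2r //.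
  by case: n n2 => [|[|[|]]] // _; rewrite ?sub0r ?normrN ?subrr ?normr0 ?ler0n //
    ?normr1 ?ler1n // -[1]/(1%:R) -natrB // normr_nat ler_nat.
have four0 : 4%:R != 0 :> F by rewrite (natrM _ 2 2) mulf_neq0.
have [|e e2 eG] := @gauss_scale (- (4%:R * b)^-1).
  by rewrite oppr_eq0 invr_eq0 mulf_neq0.
have e0 : e != 0 by rewrite -sqrf_eq0 e2 oner_eq0.
have eN : `|e| = 1.
  by apply/eqP; rewrite -(@pexpr_eq1 _ _ 2) ?normr_ge0 // -normrX e2 normr1.
rewrite -[X in X <= _]mul1r -{1}eN -normrM mulr_sumr.
have -> : \sum_(s | s != 0) e * (gauss s * chi (a * s + b / s)) =
    \sum_v chi v * ((a - v ^+ 2 / (4%:R * b) == 0)%:R * q - 1).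
  transitivity (\sum_(s | s != 0) \sum_v chi v * chi (s * (a - v ^+ 2 / (4%:R * b)))).
    apply: eq_bigr => s s0; rewrite mulrA -eG // (acharD chiP) [gauss _ * _]mulrC.
    rewrite -mulrA [a * s]mulrC.
    have -> : chi (b / s) * gauss (- (4%:R * b)^-1 * s) =
        \sum_v chi (v - s * (v ^+ 2 / (4%:R * b))).
      rewrite /gauss mulr_sumr (reindex_inj (addIr (- (2%:R * b / s)))) /=.
      apply: eq_bigr => v _; rewrite -(acharD chiP); congr (chi _).
      by field; rewrite s0 four0 b0.
    rewrite mulr_sumr; apply: eq_bigr => v _; rewrite -!(acharD chiP); congr (chi _).
    by ring.
  rewrite exchange_big /=; apply: eq_bigr => v _; rewrite -mulr_sumr.
  by rewrite -sum_ne0.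
under eq_bigr => v _ do rewrite mulrBr mulr1.
rewrite sumrB (sum_achar chiP nt) subr0.
apply: (le_trans (ler_norm_sum _ _ _)).
under eq_bigr => v _ do rewrite normrM (normr_achar chiP) mul1r normrM normr_nat gtr0_norm //.
rewrite -mulr_suml ler_pM2r // -natr_sum ler_nat.
apply: leq_trans (card_sqr_le2 (a * (4%:R * b))); rewrite -sum1dep_card [leqRHS]big_mkcond /=.
apply: leq_sum => v _; rewrite subr_eq0; case: eqP => //= ->.
by rewrite divfK ?eqxx ?mulf_neq0.
Qed.

End GaussSums.

Section Dot.
Variables (F : finFieldType) (d : nat).
Implicit Types x y z : 'cV[F]_d.

Definition dot x y : F := \sum_(i < d) x i 0 * y i 0.

Lemma dotC x y : dot x y = dot y x.
Proof. by apply: eq_bigr => i _; rewrite mulrC. Qed.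

Lemma dotDr x y z : dot x (y + z) = dot x y + dot x z.
Proof. by rewrite -big_split; apply: eq_bigr => i _; rewrite mxE mulrDr. Qed.

Lemma dotDl x y z : dot (x + y) z = dot x z + dot y z.
Proof. by rewrite dotC dotDr ![dot z _]dotC. Qed.

Lemma dotNr x y : dot x (- y) = - dot x y.
Proof. by rewrite /dot -sumrN; apply: eq_bigr => i _; rewrite mxE mulrN. Qed.

Lemma dotZr a x y : dot x (a *: y) = a * dot x y.
Proof. by rewrite /dot mulr_sumr; apply: eq_bigr => i _; rewrite mxE mulrCA. Qed.

Lemma dot0r x : dot x 0 = 0.
Proof. by rewrite /dot big1 // => i _; rewrite mxE mulr0. Qed.

Lemma dotE x y : dot x y = (x^T *m y) 0 0.
Proof. by rewrite mxE; apply: eq_bigr => i _; rewrite mxE. Qed.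

Lemma dot_delta x i : dot (delta_mx i 0) x = x i 0.
Proof.
rewrite /dot (bigD1 i) //= big1 => [|j ji]; first by rewrite mxE !eqxx mul1r addr0.
by rewrite mxE (negPf ji) mul0r.
Qed.

Lemma sqnorm_dot x : sqnorm x = dot x x.
Proof. by apply: eq_bigr => i _; rewrite expr2. Qed.

Lemma sqnormD x y : sqnorm (x + y) = sqnorm x + 2%:R * dot x y + sqnorm y.
Proof. by rewrite !sqnorm_dot dotDl !dotDr [dot y x]dotC; ring. Qed.

Lemma sqnormZ a x : sqnorm (a *: x) = a ^+ 2 * sqnorm x.
Proof. by rewrite !sqnorm_dot dotZr dotC dotZr mulrA expr2. Qed.

Section DotChar.
Variable chi : F -> algC.
Hypotheses (chiP : additive_char chi) (nt : exists a : F, chi a != 1).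

Lemma sum_achar_dot x : \sum_m chi (dot m x) = (x == 0)%:R * #|F|%:R ^+ d.
Proof.
have [->|x0] := eqVneq x 0.
  under eq_bigr => m _ do rewrite dot0r (achar0 chiP).
  by rewrite sumr_const card_mx muln1 natrX mul1r.
rewrite mul0r; have := sum_achar (achar_comp (fun y z => dotDl y z x) chiP); apply.
have [i xi] : exists i, x i 0 != 0.
  apply/existsP; apply: contraT; rewrite negb_exists => /forallP all0.
  case/negP: x0; apply/eqP/colP => i; rewrite mxE; apply/eqP.
  by move: (all0 i); rewrite negbK.
have [a na] := nt; exists ((a / x i 0) *: delta_mx i 0).
by rewrite /= dotC dotZr dotC dot_delta divfK.
Qed.

End DotChar.
End Dot.

(** * The Fourier transform of spheres *)

Section Sphere.
Variables (F : finFieldType) (p d : nat) (chi : F -> algC).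
Hypotheses (pF : p \in [pchar F]) (oddF : odd #|F|) (chiF : frobenius_char p chi).
Let chiP : additive_char chi. Proof. by case: chiF. Qed.
Let nt : exists x, chi x != 1. Proof. by case: chiF. Qed.
Let q : algC := #|F|%:R.
Let two0 : 2%:R != 0 :> F := odd_card_two_neq0 oddF.
Let four0 : 4%:R != 0 :> F. Proof. by rewrite (natrM _ 2 2) mulf_neq0. Qed.
Let q0 : 0 < q := card_field_gt0 F.
Implicit Types (m v : 'cV[F]_d) (t s : F).

Definition sphere_hat t v : algC := \sum_(m : 'cV[F]_d | sqnorm m == t) chi (dot m v).

(** The character of a sum of squares factors over the coordinates. *)
Lemma sum_sqnorm_char s :
  \sum_(m : 'cV[F]_d) chi (s * sqnorm m) = gauss chi s ^+ d.
Proof.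
rewrite -[X in _ = _ ^+ X]card_ord -prodr_const bigA_distr_bigA /=.
pose f (h : {ffun 'I_d -> F}) : 'cV[F]_d := \col_i h i.
have f_bij : bijective f.
  exists (fun m : 'cV[F]_d => [ffun i => m i 0]) => [h|m].
    by apply/ffunP => i; rewrite ffunE mxE.
  by apply/colP => i; rewrite mxE ffunE.
rewrite (reindex f) /=; last exact: onW_bij.
apply: eq_bigr => h _; rewrite -(achar_sum chiP) mulr_sumr; congr (chi _).
by apply: eq_bigr => i _; rewrite mxE.
Qed.

Lemma sum_quadratic_char s v : s != 0 ->
  \sum_m chi (s * sqnorm m + dot m v)
    = chi (- sqnorm v / (4%:R * s)) * gauss chi s ^+ d.
Proof.
move=> s0; rewrite -sum_sqnorm_char mulr_sumr.
rewrite (reindex_inj (addIr (- (2%:R * s)^-1 *: v))) /=; apply: eq_bigr => m _.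
rewrite -(acharD chiP); congr (chi _).
rewrite sqnormD sqnormZ dotDl dotZr [dot (_ *: _) v]dotC dotZr -sqnorm_dot.
by field; rewrite s0 two0 four0.
Qed.

(** Detect sqnorm m = t by additive characters s, then complete the square in m. *)
Lemma sphere_hatE t v :
  q * sphere_hat t v = (v == 0)%:R * q ^+ d +
    \sum_(s | s != 0) gauss chi s ^+ d * chi (- t * s + (- sqnorm v / 4%:R) / s).
Proof.
rewrite /sphere_hat mulr_sumr big_mkcond /=.
transitivity (\sum_m \sum_s chi (s * (sqnorm m - t)) * chi (dot m v)).
  apply: eq_bigr => m _; rewrite -mulr_suml.
  under eq_bigr => s _ do rewrite mulrC.
  rewrite (sum_achar_scale chiP nt) subr_eq0; case: eqP => _; first by rewrite mul1r.
  by rewrite !mul0r.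
rewrite exchange_big /= (bigD1 0) //=; congr (_ + _).
  rewrite -(sum_achar_dot chiP nt); apply: eq_bigr => m _.
  by rewrite mul0r (achar0 chiP) mul1r.
apply: eq_bigr => s s0; rewrite (acharD chiP) [chi _ * chi _]mulrC mulrA.
have -> : chi (- sqnorm v / 4%:R / s) = chi (- sqnorm v / (4%:R * s)).
  by congr (chi _); field; rewrite s0.
rewrite [_ * chi (- sqnorm v / _)]mulrC -sum_quadratic_char // mulr_suml.
apply: eq_bigr => m _; rewrite -!(acharD chiP); congr (chi _); ring.
Qed.

Lemma sphere_hat_real t v : sphere_hat t v \is Num.real.
Proof.
apply/CrealP; rewrite /sphere_hat rmorph_sum /= (reindex_inj oppr_inj) /=.
apply: eq_big => m; first by rewrite -scaleN1r sqnormZ sqrrN expr1n mul1r.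
by move=> _; rewrite -(acharN chiP) dotC dotNr opprK dotC.
Qed.

Lemma sqrtC_ge1 : 1 <= sqrtC q.
Proof. by rewrite -sqrtC1 ler_sqrtC ?nnegrE ?ler0n // /q ler1n -(ltr0n algC). Qed.

Lemma gauss_norm s : s != 0 -> `|gauss chi s| = sqrtC q.
Proof.
move=> s0; rewrite /q -(gauss_normK oddF chiP nt s0) sqrCK //.
Qed.

(** The number of points is the transform at 0, where the terms s <> 0 are at most
    q^(d/2) in absolute value, so together at most q^d since d >= 2. *)
Lemma card_sphere_le t : (2 <= d)%N ->
  #|[set m : 'cV[F]_d | sqnorm m == t]|%:R <= 2%:R * q ^+ d.-1.
Proof.
move=> d2; rewrite -(ler_pM2l q0) mulrCA -exprS prednK; last by case: d d2.
have -> : #|[set m : 'cV[F]_d | sqnorm m == t]|%:R = sphere_hat t 0.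
  rewrite /sphere_hat (eq_bigr (fun=> 1)) => [|m _]; last by rewrite dot0r (achar0 chiP).
  by rewrite sumr_const; congr (_ *+ _); apply: eq_card => m; rewrite inE.
rewrite sphere_hatE eqxx mul1r mulr2n mulrDl mul1r lerD2l.
set S := \sum_(_ | _) _.
have SE : S = q * sphere_hat t 0 - q ^+ d.
  by rewrite sphere_hatE eqxx mul1r addrAC subrr add0r.
have SR : S \is Num.real.
  rewrite SE rpredB ?rpredX ?realn // rpredM ?realn //.
  exact: sphere_hat_real.
apply: (le_trans (real_ler_norm SR)); apply: (le_trans (ler_norm_sum _ _ _)).
apply: (@le_trans _ _ (\sum_(s : F) sqrtC q ^+ d)).
  rewrite [leLHS]big_mkcond /=; apply: ler_sum => s _; case: eqP => [_|/eqP s0].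
    by rewrite exprn_ge0 // sqrtC_ge0 ltW.
  by rewrite normrM (normr_achar chiP) mulr1 normrX gauss_norm.
rewrite sumr_const -mulr_natl -/q; case: d d2 => [|[|e]] // _.
have -> : sqrtC q ^+ e.+2 = q * sqrtC q ^+ e by rewrite !exprS mulrA -expr2 sqrtCK.
rewrite 2!exprS !ler_pM2l // lerXn2r ?nnegrE ?sqrtC_ge0 ?ler0n // -{2}[q]sqrtCK expr2.
by rewrite ler_peMl ?sqrtC_ge0 ?ler0n // sqrtC_ge1.
Qed.

(** The arithmetic condition under which no cone contributes a large positive
    value to the transforms of spheres. *)
Definition good_dim := ((3 <= d)%N /\ odd d) \/
  ((d = 2 %[mod 4])%N /\ (#|F| = 3 %[mod 4])%N).

(** Euler's criterion: (q - 1)/2 is odd. *)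
Lemma nonsquareN1 : (#|F| = 3 %[mod 4])%N -> forall v : F, v ^+ 2 != -1.
Proof.
move=> q3 v; apply: contraNneq two0 => v2.
have [k Fk] : exists k, #|F| = (2 * k.*2.+1).+1.
  exists (#|F| %/ 4)%N; have := divn_eq #|F| 4; rewrite q3; move: (_ %/ _)%N => k; lia.
have v0 : v != 0 by apply: contra_eq_neq v2 => ->; rewrite expr0n eq_sym oppr_eq0 oner_eq0.
have : v ^+ (2 * k.*2.+1) = 1.
  by apply: (mulIf v0); rewrite -exprSr -Fk expf_card mul1r.
rewrite exprM v2 exprS -mul2n exprM sqrrN !expr1n mulr1 => /eqP.
by rewrite eq_sym -subr_eq0 opprK.
Qed.

(** Only this one-sided bound can hold: for t = b = 0 the sum is q - 1. *)
Lemma kloosterman_le t b :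
  - \sum_(s | s != 0) chi (- t * s + b / s) <= 2%:R * sqrtC q.
Proof.
have sq2 : 1 <= 2%:R * sqrtC q by rewrite mulr_ege1 ?ler1n ?sqrtC_ge1.
have sum_ne0 u : \sum_(s | s != 0) chi (u * s) = (u == 0)%:R * q - 1.
  rewrite -(sum_achar_scale chiP nt) [X in _ = X - 1](bigD1 0) //= mulr0 (achar0 chiP).
  by rewrite addrAC subrr add0r.
have sum_b u : - ((u == 0)%:R * q - 1) <= 2%:R * sqrtC q.
  rewrite opprB; apply: le_trans sq2; rewrite gerBl.
  by rewrite mulr_ge0 ?ler0n.
have [->|t0] := eqVneq t 0.
  rewrite (reindex_inj invr_inj) /=.
  rewrite (eq_bigl (fun s => s != 0)) => [|s]; last by rewrite invr_eq0.
  by under eq_bigr => s _ do rewrite oppr0 mul0r add0r invrK; rewrite sum_ne0 sum_b.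
have [->|b0] := eqVneq b 0.
  by under eq_bigr => s _ do rewrite mul0r addr0; rewrite sum_ne0 sum_b.
(* The substitution s |-> - s / t normalises the first coefficient to 1. *)
have nt0 : - t != 0 by rewrite oppr_eq0.
have -> : \sum_(s | s != 0) chi (- t * s + b / s) = kloosterman chi (- t * b).
  rewrite /kloosterman [RHS](reindex_inj (mulfI nt0)) /=.
  apply: eq_big => s; first by rewrite mulf_eq0 (negPf nt0).
  by move=> s0; congr (chi _); field; rewrite s0.
have kR := kloosterman_real (- t * b) chiP.
rewrite lerNl; have := kloosterman_bound pF oddF chiF (mulf_neq0 nt0 b0).
have -> : (4 * #|F|)%:R = (2%:R * sqrtC q) ^+ 2.
  by rewrite exprMn sqrtCK -natrX -natrM.
rewrite -real_normK // ler_sqr ?nnegrE ?normr_ge0 ?mulr_ge0 ?sqrtC_ge0 ?ler0n //.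
by rewrite real_ler_norml // => /andP[].
Qed.

(** For odd d the factor gauss(s)^(d-1) is a constant of modulus q^((d-1)/2) and
    a Salie sum remains.  In the other case -1 is a nonsquare, gauss(s)^2 = -q
    and d/2 is odd, so gauss(s)^d = - q^(d/2), and the sign is the one for which
    the bound of kloosterman_le applies. *)
Lemma sphere_decay t v : good_dim -> v != 0 ->
  sphere_hat t v <= 2%:R * sqrtC q ^+ d.-1.
Proof.
move=> gd v0; rewrite -(ler_pM2l q0).
have -> : q * (2%:R * sqrtC q ^+ d.-1) = 2%:R * sqrtC q ^+ d.+1.
  rewrite mulrCA -{1}[q]sqrtCK -exprD; congr (_ * _ ^+ _).
  by case: gd => -[]; [case: d|case: (d)].
have hE := sphere_hatE t v; rewrite (negPf v0) mul0r add0r in hE.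
case: gd => [[d3 oddd]|[d2 q3]].
  have [e e2 eG] := gauss_sqr oddF chiP nt.
  have dE : d = (2 * d./2).+1 by rewrite -[LHS]odd_double_half oddd mul2n.
  have eN : `|e| = 1.
    by apply/eqP; rewrite -(@pexpr_eq1 _ _ 2) ?normr_ge0 // -normrX e2 normr1.
  apply: (le_trans (real_ler_norm _)).
    by rewrite rpredM ?realn // sphere_hat_real.
  rewrite hE.
  have -> : \sum_(s | s != 0) gauss chi s ^+ d *
        chi (- t * s + - sqnorm v / 4%:R / s) = (e * q) ^+ d./2 *
      \sum_(s | s != 0) gauss chi s * chi (- t * s + - sqnorm v / 4%:R / s).
    rewrite mulr_sumr; apply: eq_bigr => s s0; rewrite mulrA; congr (_ * _).
    by rewrite {1}dE exprSr exprM eG.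
  rewrite normrM normrX normrM eN mul1r (gtr0_norm q0).
  apply: (le_trans (ler_wpM2l _ (salie_bound oddF chiP nt _ _))).
    by rewrite exprn_ge0 // ltW.
  rewrite mulrCA -exprSr {2}dE -{1}[q]sqrtCK -exprM.
  by rewrite mulnS add2n.
have nsq := nonsquareN1 q3.
have [e [dE odde]] : exists e, d = (2 * e)%N /\ odd e.
  exists (d %/ 4).*2.+1; split; last by rewrite /= odd_double.
  have := divn_eq d 4; rewrite d2; move: (_ %/ _)%N; lia.
rewrite hE.
have -> : \sum_(s | s != 0) gauss chi s ^+ d *
      chi (- t * s + - sqnorm v / 4%:R / s) = q ^+ e *
    - \sum_(s | s != 0) chi (- t * s + - sqnorm v / 4%:R / s).
  rewrite mulrN -mulNr mulr_sumr; apply: eq_bigr => s s0; congr (_ * _).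
  rewrite dE exprM (gauss_sqr_nonsquare oddF chiP nt nsq s0).
  by rewrite exprNn -signr_odd odde mulN1r.
apply: (le_trans (ler_wpM2l _ (kloosterman_le _ _))).
  by rewrite exprn_ge0 // ltW.
by rewrite mulrCA -{1}[q]sqrtCK -exprM -exprSr -dE.
Qed.

Definition set_hat (A : {set 'cV[F]_d}) m : algC := \sum_(x in A) chi (dot m x).

(** Expanding |Ahat|^2 gives the sum of sphere_hat t (x - y) over x, y in A; the
    two terms come from x = y and from x <> y. *)
Lemma sphere_energy (A : {set 'cV[F]_d}) t : good_dim ->
  \sum_(m | sqnorm m == t) `|set_hat A m| ^+ 2
    <= 2%:R * (q ^+ d.-1 * #|A|%:R + sqrtC q ^+ d.-1 * #|A|%:R ^+ 2).
Proof.
move=> gd.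
have d2 : (2 <= d)%N.
  case: gd => [[d3 _]|[d2 _]]; first exact: ltnW.
  by case: d d2 => [|[]].
have -> : \sum_(m | sqnorm m == t) `|set_hat A m| ^+ 2 =
    \sum_(x in A) \sum_(y in A) sphere_hat t (x - y).
  rewrite /sphere_hat; under [RHS]eq_bigr => x _ do rewrite exchange_big /=.
  rewrite [RHS]exchange_big /=; apply: eq_bigr => m _.
  rewrite normCK {1}/set_hat mulr_suml; apply: eq_bigr => x _.
  rewrite /set_hat rmorph_sum /= mulr_sumr; apply: eq_bigr => y _.
  by rewrite -(acharN chiP) -(acharD chiP) dotDr dotNr.
apply: (@le_trans _ _ (\sum_(x in A) (2%:R * q ^+ d.-1 +
    \sum_(y in A) 2%:R * sqrtC q ^+ d.-1))).
  apply: ler_sum => x xA; rewrite [leLHS](bigD1 x) //=.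
  apply: lerD.
    rewrite subrr; apply: le_trans (card_sphere_le t d2).
    rewrite /sphere_hat (eq_bigr (fun=> 1)) => [|m _]; last by rewrite dot0r (achar0 chiP).
    by rewrite sumr_const ler_nat subset_leq_card //; apply/subsetP => m; rewrite inE.
  rewrite [leRHS](bigD1 x) //= -[leLHS]add0r lerD ?mulr_ge0 ?exprn_ge0 ?sqrtC_ge0 ?ler0n //.
  by apply: ler_sum => y /andP[_ yx]; rewrite sphere_decay // subr_eq0 eq_sym.
rewrite !sumr_const mulrnDl.
rewrite -3!mulr_natr le_eqVlt; apply/orP; left; apply/eqP; ring.
Qed.

End Sphere.

(** * Stabilisers in the orthogonal group *)

Lemma card_le_fibers (T U : finType) (f : T -> U) (A : {set T}) (B : {set U}) n :
  (forall x, x \in A -> f x \in B) ->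
  (forall y, (#|[set x in A | f x == y]| <= n)%N) -> (#|A| <= #|B| * n)%N.
Proof.
move=> fAB fib; rewrite -sum1_card (partition_big f (mem B)) //=.
rewrite -sum_nat_const; apply: leq_sum => y _; apply: leq_trans (fib y).
by rewrite -sum1_card; apply: eq_leq; apply: eq_bigl => x; rewrite inE.
Qed.

Section OrthogonalGroup.
Variables (F : finFieldType) (d : nat).
Hypothesis oddF : odd #|F|.
Let two0 : 2%:R != 0 :> F := odd_card_two_neq0 oddF.
Local Notation O := (orthogonal_group F d).
Implicit Types (g h M : 'M[F]_d) (x y u c w : 'cV[F]_d) (S : {set 'I_d}).

Lemma orthogonal_sqnorm g x : g \in O -> sqnorm (g *m x) = sqnorm x.
Proof. by rewrite inE => /forallP/(_ x)/eqP. Qed.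

Lemma orthogonal_dot g x y : g \in O -> dot (g *m x) (g *m y) = dot x y.
Proof.
move=> gO; have := orthogonal_sqnorm (x + y) gO.
rewrite mulmxDr !sqnormD !orthogonal_sqnorm // => /addIr/addrI.
exact: (mulfI two0).
Qed.

Lemma dot_mulmx g x y : dot (g *m x) y = dot x (g^T *m y).
Proof. by rewrite !dotE trmx_mul mulmxA. Qed.

Lemma dot_inj x y : (forall z, dot z x = dot z y) -> x = y.
Proof. by move=> xy; apply/colP => i; rewrite -!dot_delta. Qed.

Lemma orthogonal_trmx_mul g : g \in O -> g^T *m g = 1%:M.
Proof.
move=> gO; have key x : (g^T *m g) *m x = x.
  by apply: dot_inj => z; rewrite -mulmxA -dot_mulmx orthogonal_dot.
apply/matrixP => i j; have := congr1 (fun x => x i 0) (key (delta_mx j 0)).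
by rewrite -colE !mxE andbT.
Qed.

Lemma orthogonal_mul_trmx g : g \in O -> g *m g^T = 1%:M.
Proof. by move=> gO; apply/mulmx1C/orthogonal_trmx_mul. Qed.

Lemma mem_orthogonal g : g^T *m g = 1%:M -> g \in O.
Proof.
move=> gTg; rewrite inE; apply/forallP => x; rewrite !sqnorm_dot dot_mulmx.
by rewrite mulmxA gTg mul1mx.
Qed.

Lemma orthogonal_trmx g : g \in O -> g^T \in O.
Proof. by move=> gO; apply: mem_orthogonal; rewrite trmxK orthogonal_mul_trmx. Qed.

Lemma orthogonal_mulmx g h : g \in O -> h \in O -> g *m h \in O.
Proof.
move=> gO hO; apply: mem_orthogonal.
by rewrite trmx_mul -mulmxA (mulmxA g^T) orthogonal_trmx_mul // mul1mx orthogonal_trmx_mul.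
Qed.

(** The factor 2 on the middle coefficient suits the polarisation of a quadratic
    form; the extra term covers the polynomials that may vanish identically. *)
Lemma card_quadratic_roots (al be ga : F) :
  (#|[set t | (al * t ^+ 2 + 2%:R * be * t + ga == 0)%R]|
    <= 2 + #|F| * ((al == 0)%R && (be == 0)%R))%N.
Proof.
have [->|al0] := eqVneq al 0.
  have [->|be0] := eqVneq be 0.
    by rewrite muln1 (leq_trans (max_card _)) // leq_addl.
  rewrite muln0 addn0.
  apply: (@leq_trans #|[set (- ga / (2%:R * be))%R]|); last by rewrite cards1.
  apply: subset_leq_card; apply/subsetP => t; rewrite !inE mul0r add0r addr_eq0 => /eqP <-.
  by rewrite mulrC mulKf // mulf_neq0.
rewrite muln0 addn0; apply: leq_trans (card_sqr_le2 (be ^+ 2 - al * ga)).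
have inj : injective (fun t => al * t + be) by move=> s t /addIr/(mulfI al0).
rewrite -[leqLHS](card_imset _ inj).
apply: subset_leq_card; apply/subsetP => _ /imsetP[t + ->].
rewrite !inE => /eqP t0; rewrite -subr_eq0; apply/eqP.
transitivity (al * (al * t ^+ 2 + 2%:R * be * t + ga)); first by ring.
by rewrite t0 mulr0.
Qed.

Definition vanishing S : {set 'cV[F]_d} := [set c : 'cV[F]_d | [forall i in S, c i 0 == 0]].

Lemma vanishingP S c : reflect (forall i, i \in S -> c i 0 = 0) (c \in vanishing S).
Proof. by rewrite inE; apply: (iffP 'forall_in_eqP). Qed.

Lemma card_vanishing S : #|vanishing S| = (#|F| ^ (d - #|S|))%N.
Proof.
pose P (i : 'I_d) : pred F := if i \in S then pred1 0 else predT.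
pose f (h : {ffun 'I_d -> F}) : 'cV[F]_d := \col_i h i.
have f_inj : injective f.
  by move=> h k /colP hk; apply/ffunP => i; have := hk i; rewrite !mxE.
transitivity #|family P|.
  rewrite -(card_imset _ f_inj); apply: eq_card => c; apply/vanishingP/imsetP.
    move=> cS; exists [ffun i => c i 0]; last by apply/colP => i; rewrite mxE ffunE.
    apply/familyP => i; rewrite ffunE /P; case: ifP => // iS.
    by rewrite inE cS.
  case=> h /familyP hP -> i iS; rewrite mxE; have := hP i.
  by rewrite /P iS inE => /eqP.
rewrite card_family foldrE big_map big_enum /=.
rewrite (eq_bigr (fun i => if i \in S then 1 else #|F|)%N) => [|i _]; last first.
  by rewrite /P; case: ifP => _; rewrite ?card1.
rewrite (bigID (mem S)) /= big1 => [|i ->//]; rewrite mul1n.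
rewrite (eq_bigr (fun=> #|F|)) => [|i /negbTE->//].
rewrite prod_nat_const; congr (_ ^ _)%N; have := cardsC S; rewrite card_ord => cS.
rewrite -[RHS](congr1 (subn^~ #|S|) cS) addKn.
by apply: eq_card => i; rewrite inE.
Qed.

Section Frame.
Variable M : 'M[F]_d.
Hypothesis unitM : M \in unitmx.
Let N := (invmx M)^T.

Let dot_frame i c : dot (col i M) (N *m c) = c i 0.
Proof.
rewrite colE dot_mulmx dot_delta mulmxA -trmx_mul mulVmx //.
by rewrite trmx1 mul1mx.
Qed.

(** The possible images u of the basis vector b_j under an orthogonal map that
    fixes b_i for i in S.  In the coordinates c = M^T (u - b_j), dual to the
    basis, the linear conditions say that c vanishes on S.  On each line in
    direction e_j, which is indexed by a vector w vanishing on j |: S, the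
    condition on the norm is a quadratic equation; its linear coefficient, which
    up to a factor 2 is be w = 1 + <w, e_j>, vanishes together with its leading coefficient for at
    most |W| / (q - 1) values of w, because the affine condition <w, e_j> = -1
    is met at most once on each punctured line through 0. *)
Lemma card_frame_extension S j : j \notin S ->
  (#|[set u | [forall i in S, dot (col i M) u == dot (col i M) (col j M)]
      && (sqnorm u == sqnorm (col j M))]|
    <= 4 * #|F| ^ (d - #|S|.+1))%N.
Proof.
move=> jS; set U := [set u | _]; set b := col j M.
pose e : 'cV[F]_d := N *m delta_mx j 0.
pose al := sqnorm e; pose be w := dot (N *m w) e + 1.
pose ga w := sqnorm (N *m w).
pose W := vanishing (j |: S).
have cW : #|W| = (#|F| ^ (d - #|S|.+1))%N.
  by rewrite card_vanishing cardsU1 jS.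
pose f u : 'cV[F]_d * F :=
  let c := M^T *m (u - b) in (c - c j 0 *: delta_mx j 0, c j 0).
pose T := [set z : 'cV[F]_d * F | (z.1 \in W) &&
  (al * z.2 ^+ 2 + 2%:R * be z.1 * z.2 + ga z.1 == 0)%R].
have f_inj : injective f.
  move=> u v fuv; have /= e2 := congr1 snd fuv; have /= := congr1 fst fuv.
  rewrite e2 => /addIr/(congr1 (mulmx N)).
  rewrite !mulmxA -trmx_mul mulmxV // trmx1 !mul1mx; exact: addIr.
have UT : (#|U| <= #|T|)%N.
  rewrite -(card_imset _ f_inj); apply: subset_leq_card; apply/subsetP => _ /imsetP[u + ->].
  rewrite !inE => /andP[/'forall_in_eqP uS /eqP uj] /=.
  set c := M^T *m (u - b).
  have ci i : c i 0 = dot (col i M) (u - b).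
    by rewrite -dot_delta /c -dot_mulmx -colE.
  have uE : u = b + N *m c.
    by rewrite /c mulmxA -trmx_mul mulmxV // trmx1 mul1mx addrC subrK.
  clearbody c; apply/andP; split.
    apply/'forall_in_eqP => i; rewrite !inE !mxE eqxx andbT => /orP[/eqP->|iS].
      by rewrite eqxx mulr1 subrr.
    have /negPf -> : i != j by apply: contraNneq jS => <-.
    by rewrite mulr0 subr0 ci dotDr dotNr uS // subrr.
  apply/eqP; move: uj; rewrite [in LHS]uE sqnormD dot_frame.
  rewrite -[RHS]addr0 -addrA => /addrI eq0; rewrite -[RHS]eq0.
  set t := c j 0; set w := c - t *: delta_mx j 0.
  have -> : N *m c = N *m w + t *: e.
    by rewrite /e scalemxAr -mulmxDr subrK.
  rewrite sqnormD sqnormZ dotZr /al /be /ga; ring.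
pose bad := [set w in W | (al == 0) && (be w == 0)].
have TW : (#|T| <= 2 * #|W| + #|F| * #|bad|)%N.
  rewrite -sum1_card (partition_big (fun z => z.1) (mem W)) /=; last first.
    by move=> z; rewrite inE => /andP[].
  apply: leq_trans (_ : \sum_(w in W) (2 + #|F| * ((al == 0)%R && (be w == 0)%R)) <= _)%N.
    apply: leq_sum => w wW; apply: leq_trans (card_quadratic_roots al (be w) (ga w)).
    have inj : injective (fun t : F => (w, t)) by move=> s t /(congr1 snd).
    rewrite sum1dep_card -[leqRHS](card_imset _ inj).
    apply: subset_leq_card; apply/subsetP => [[w' t]].
    rewrite !inE /= => /andP[/andP[_ eq0] /eqP ew].
    by apply/imsetP; exists t; rewrite ?inE -?ew.
  rewrite big_split /= sum_nat_const mulnC leq_add2l -big_distrr leq_mul2l; apply/orP; right.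
  rewrite -sum1_card [leqRHS]big_mkcond [leqLHS]big_mkcond; apply: leq_sum => w _.
  by rewrite [w \in bad]inE; case: (w \in W) => //=; case: (_ && _).
(* The scalings t w, t <> 0, of the exceptional w are distinct elements of W. *)
have bad_le : (#|F| * #|bad| <= 2 * #|W|)%N.
  have q1 := finNzRing_gt1 F.
  apply: leq_trans (_ : 2 * (#|F|.-1 * #|bad|) <= _)%N.
    rewrite mulnA leq_mul2r; apply/orP; right.
    by move: q1; move: (#|_|) => n; clear; lia.
  rewrite leq_mul2l /= -(cardC1 (0 : F)).
  have -> : #|predC1 (0 : F)| = #|[set t : F | t != 0]|.
    by apply: eq_card => t; rewrite !inE.
  rewrite -cardsX.
  have inj : {in setX [set t : F | t != 0] bad &, injective (fun z => z.1 *: z.2)}.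
    move=> [s w] [t v]; rewrite !inE /= => /andP[s0 /andP[_ /andP[_ /eqP w1]]].
    move=> /andP[t0 /andP[_ /andP[_ /eqP v1]]] eq_sw.
    have dotN x : be x = 0 -> dot (N *m x) e = -1.
      by move/eqP; rewrite /be addr_eq0 => /eqP.
    have st : s = t.
      have := congr1 (fun x => dot e (N *m x)) eq_sw.
      rewrite -!scalemxAr !dotZr ![dot e _]dotC !dotN // !mulrN1.
      exact: oppr_inj.
    by move: eq_sw; rewrite st => /(scalerI t0) ->.
  rewrite -(card_in_imset inj); apply: subset_leq_card; apply/subsetP.
  move=> _ /imsetP[[t w] + ->]; rewrite inE /= => /andP[_].
  rewrite inE => /andP[/vanishingP wW _]; apply/vanishingP => i iS.
  by rewrite mxE wW // mulr0.
rewrite -cW; apply: leq_trans UT _; apply: leq_trans TW _.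
by apply: leq_trans (leq_add (leqnn _) bad_le) _; rewrite -mulnDl.
Qed.

Definition frame_stab S : {set 'M[F]_d} :=
  [set h in O | [forall i in S, h *m col i M == col i M]].

(** Left translation by the inverse of one element of A embeds A into B. *)
Lemma card_orthogonal_fiber (A : {set 'M[F]_d}) (B : {set 'M[F]_d}) :
  (forall h k, h \in A -> k \in A -> h^T *m k \in B) -> A \subset O ->
  (#|A| <= #|B|)%N.
Proof.
move=> AB /subsetP AO; have [->|[h hA]] := set_0Vmem A; first by rewrite cards0.
have inj : injective (fun k : 'M[F]_d => h^T *m k).
  move=> k l /(congr1 (fun l => h *m l)).
  by rewrite !mulmxA orthogonal_mul_trmx ?AO // !mul1mx.
rewrite -[leqLHS](card_imset _ inj).
apply: subset_leq_card; apply/subsetP => _ /imsetP[k kA ->].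
exact: AB.
Qed.

Lemma orthogonal_trmx_fix h k x : h \in O -> h *m x = k *m x -> h^T *m k *m x = x.
Proof. by move=> hO hk; rewrite -mulmxA -hk mulmxA orthogonal_trmx_mul // mul1mx. Qed.

(** Orbit-stabiliser along the basis: adding j to S divides the stabiliser by at
    most the number of possible images of b_j. *)
Lemma card_frame_stab S :
  (#|frame_stab S| <= 4 ^ (d - #|S|) * #|F| ^ 'C(d - #|S|, 2))%N.
Proof.
move cS: (d - #|S|)%N => k; elim: k => [|k IH] in S cS *.
  rewrite expn0 bin0n expn0 muln1.
  have ST : S = setT.
    apply/eqP; rewrite eqEcard subsetT cardsT card_ord.
    by rewrite -subn_eq0 cS.
  rewrite -(cards1 (1%:M : 'M[F]_d)); apply: subset_leq_card; apply/subsetP => h.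
  rewrite !inE => /andP[_ /'forall_in_eqP hM]; apply/eqP.
  suff hMM : h *m M = M by rewrite -[h]mulmx1 -(mulmxV unitM) mulmxA hMM.
  apply/matrixP => i j; have := congr1 (fun x => x i 0) (hM j _).
  by rewrite ST inE colE mulmxA -!colE !mxE => ->.
have [j jS] : exists j, j \notin S.
  apply/existsP; apply: contraT; rewrite negb_exists => /forallP all_S.
  have : S = setT by apply/setP => i; have := all_S i; rewrite negbK inE.
  by move=> ST; move: cS; rewrite ST cardsT card_ord subnn.
have cS' : (d - #|j |: S| = k)%N by rewrite cardsU1 jS add1n subnS cS.
have {IH} := IH _ cS' => IH.
have cSj : (d - #|S|.+1 = k)%N by rewrite subnS cS.
have := card_frame_extension jS; rewrite cSj.
set U := [set u | _] => cU.
have step : (#|frame_stab S| <= #|U| * #|frame_stab (j |: S)|)%N.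
  apply: (card_le_fibers (f := fun h => h *m col j M)) => [h|y].
    rewrite !inE => /andP[hO /'forall_in_eqP hS].
    have hO' : h \in O by rewrite inE.
    rewrite orthogonal_sqnorm // eqxx andbT; apply/'forall_in_eqP => i iS.
    by rewrite -{1}(hS _ iS) orthogonal_dot.
  apply: card_orthogonal_fiber => [h l|]; last first.
    by apply/subsetP => h; rewrite inE => /andP[]; rewrite inE => /andP[].
  rewrite inE => /andP[]; rewrite inE => /andP[hO /'forall_in_eqP hS] /eqP hj.
  rewrite inE => /andP[]; rewrite inE => /andP[lO /'forall_in_eqP lS] /eqP lj.
  rewrite inE orthogonal_mulmx ?orthogonal_trmx //=; apply/'forall_in_eqP => i.
  rewrite !inE => /orP[/eqP->|iS]; rewrite orthogonal_trmx_fix //.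
    by rewrite hj lj.
  by rewrite hS ?lS.
apply: leq_trans step _; apply: leq_trans (leq_mul cU IH) _.
by rewrite expnS binS bin1 expnD [(#|F| ^ _ * _)%N]mulnC mulnACA.
Qed.

End Frame.

(** The maps that send y to x form a coset of the stabiliser of y, or none exist.
    Completing y to a basis, the stabiliser is controlled by d - 1 further
    vectors, of which the k-th has O(q^(d-1-k)) possible images. *)
Lemma card_orthogonal_transport x y : y != 0 ->
  (#|[set g in O | g *m y == x]| <= 4 ^ d.-1 * #|F| ^ 'C(d.-1, 2))%N.
Proof.
move=> y0; have [i0 yi0] : exists i, y i 0 != 0.
  apply/existsP; apply: contraT; rewrite negb_exists => /forallP all0.
  case/negP: y0; apply/eqP/colP => i; rewrite mxE; apply/eqP.
  by move: (all0 i); rewrite negbK.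
pose M : 'M[F]_d := \matrix_(a, b) if b == i0 then y a 0 else (a == b)%:R.
have colM : col i0 M = y by apply/colP => a; rewrite !mxE eqxx.
have unitM : M \in unitmx.
  rewrite -unitmx_tr -row_free_unit; apply: inj_row_free => v vM.
  have vMa a : v 0 i0 * y a 0 + (if a == i0 then 0 else v 0 a) = 0.
    have := congr1 (fun u : 'rV[F]_d => u 0 a) vM; rewrite !mxE => e0.
    rewrite -[RHS]e0 [RHS](bigD1 i0) //= !mxE eqxx; congr (_ + _).
    case: (eqVneq a i0) => [->|ai].
      by rewrite [RHS]big1 // => b bi; rewrite !mxE (negPf bi) eq_sym (negPf bi) mulr0.
    rewrite (bigD1 a) //= !mxE (negPf ai) eqxx mulr1 big1 ?addr0 // => b /andP[bi ba].
    by rewrite !mxE (negPf bi) eq_sym (negPf ba) mulr0.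
  have vi0 : v 0 i0 = 0.
    have := vMa i0; rewrite eqxx addr0 => /eqP; rewrite mulf_eq0 (negPf yi0) orbF.
    by move/eqP.
  apply/rowP => a; rewrite mxE; have := vMa a; rewrite vi0 mul0r add0r.
  by case: eqP => [->|].
apply: leq_trans (_ : #|frame_stab M [set i0]| <= _)%N; last first.
  by have := card_frame_stab unitM [set i0]; rewrite cards1 subn1.
apply: card_orthogonal_fiber => [h k|]; last by apply/subsetP => h; rewrite inE => /andP[].
case/setIdP => hO /eqP hy /setIdP[kO /eqP ky]; apply/setIdP.
split; first by rewrite orthogonal_mulmx ?orthogonal_trmx.
apply/'forall_in_eqP => i.
by rewrite inE => /eqP ->; rewrite colM orthogonal_trmx_fix // hy.
Qed.

End OrthogonalGroup.

(** * The fluctuation of the number of incidences *)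

(** Cauchy-Schwarz against the constant 1, through 2 u v <= u^2 + v^2. *)
Lemma sqr_norm_sum_le (I : finType) (A : {set I}) (a : I -> algC) :
  `|\sum_(i in A) a i| ^+ 2 <= #|A|%:R * \sum_(i in A) `|a i| ^+ 2.
Proof.
apply: (@le_trans _ _ ((\sum_(i in A) `|a i|) ^+ 2)).
  by rewrite lerXn2r ?nnegrE ?normr_ge0 ?sumr_ge0 // ler_norm_sum.
rewrite -(ler_pM2l (ltr0n _ 2)) expr2 big_distrlr /= mulr_sumr.
have -> : 2%:R * (#|A|%:R * \sum_(i in A) `|a i| ^+ 2) =
    \sum_(i in A) \sum_(j in A) (`|a i| ^+ 2 + `|a j| ^+ 2).
  under [RHS]eq_bigr => i _ do rewrite big_split /= sumr_const.
  by rewrite big_split /= sumr_const sumrMnl !mulr_natl mulr2n.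
apply: ler_sum => i _; rewrite mulr_sumr; apply: ler_sum => j _.
rewrite -subr_ge0.
have -> : `|a i| ^+ 2 + `|a j| ^+ 2 - 2%:R * (`|a i| * `|a j|) = (`|a i| - `|a j|) ^+ 2.
  by ring.
by rewrite -realEsqr rpredB ?normr_real.
Qed.

Section Incidence.
Variables (F : finFieldType) (p d : nat) (chi : F -> algC).
Hypotheses (pF : p \in [pchar F]) (oddF : odd #|F|) (chiF : frobenius_char p chi).
Let chiP : additive_char chi. Proof. by case: chiF. Qed.
Let nt : exists x, chi x != 1. Proof. by case: chiF. Qed.
Let q : algC := #|F|%:R.
Let q0 : 0 < q := card_field_gt0 F.
Local Notation O := (orthogonal_group F d).
Local Notation V := 'cV[F]_d.
Local Notation hat := (set_hat chi).

Lemma plancherel (c : V -> algC) (P : pred V) :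
  \sum_z `|\sum_(m | P m) c m * chi (- dot m z)| ^+ 2
    = q ^+ d * \sum_(m | P m) `|c m| ^+ 2.
Proof.
transitivity (\sum_(m | P m) \sum_(n | P n)
    c m * (c n)^* * \sum_z chi (dot z (n - m))).
  under eq_bigr => z _.
    rewrite normCK rmorph_sum big_distrlr /=; over.
  rewrite exchange_big /=; apply: eq_bigr => m _.
  rewrite exchange_big /=; apply: eq_bigr => n _.
  rewrite mulr_sumr; apply: eq_bigr => z _.
  rewrite rmorphM /= -(acharN chiP) opprK mulrACA -(acharD chiP).
  by rewrite dotDr dotNr ![dot z _]dotC addrC.
rewrite mulr_sumr; apply: eq_bigr => m Pm.
rewrite (bigD1 m) //= [X in _ + X]big1 => [|n /andP[_ nm]].
  rewrite addr0 subrr (sum_achar_dot chiP nt) eqxx mul1r -normCK.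
  by rewrite mulrC.
by rewrite (sum_achar_dot chiP nt) subr_eq0 (negPf nm) mul0r mulr0.
Qed.

Lemma plancherel_set (A : {set V}) : \sum_m `|hat A m| ^+ 2 = q ^+ d * #|A|%:R.
Proof.
have := plancherel (fun=> 1) (fun x => x \in A).
under [X in _ = _ * X]eq_bigr => x _ do rewrite normr1 expr1n.
rewrite sumr_const => <-; rewrite (reindex_inj oppr_inj) /=; apply: eq_bigr => z _.
rewrite /set_hat; congr (`|_| ^+ 2); apply: eq_bigr => x _.
by rewrite mul1r dotC dotNr.
Qed.

(** The part of the Fourier expansion carried by nonzero frequencies. *)
Definition incidence_fluctuation (A B : {set V}) (r : 'M[F]_d * V) : algC :=
  \sum_(m | m != 0) hat A m * (hat B (r.1^T *m m))^* * chi (- dot m r.2).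

Lemma num_incidences_expand (A B : {set V}) (R : {set 'M[F]_d * V}) :
  q ^+ d * (num_incidences (setX A B) R)%:R - #|A|%:R * #|B|%:R * #|R|%:R
    = \sum_(r in R) incidence_fluctuation A B r.
Proof.
have -> : num_incidences (setX A B) R =
    (\sum_(r in R) \sum_(x in A) \sum_(y in B) (x == (r.1 *m y + r.2)%R))%N.
  rewrite exchange_big /=; under eq_bigr => x _ do rewrite exchange_big /=.
  rewrite pair_big pair_big /= /num_incidences -sum1_card big_mkcond [RHS]big_mkcond.
  apply: eq_bigr => [[[x y] r]] _ /=; rewrite !inE /=.
  by case: (_ \in A); case: (_ \in B); case: (_ \in R); case: (_ == _).
rewrite natr_sum mulr_sumr; apply/eqP; rewrite subr_eq; apply/eqP.
have -> : #|A|%:R * #|B|%:R * #|R|%:R = \sum_(r in R) #|A|%:R * #|B|%:R :> algC.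
  by rewrite sumr_const -[RHS]mulr_natr.
rewrite -big_split /=; apply: eq_bigr => r _.
have hat0 (S : {set V}) : hat S 0 = #|S|%:R.
  rewrite /set_hat (eq_bigr (fun=> 1)) ?sumr_const // => x _.
  by rewrite dotC dot0r (achar0 chiP).
have -> : #|A|%:R * #|B|%:R = hat A 0 * (hat B (r.1^T *m 0))^* * chi (- dot 0 r.2).
  by rewrite mulmx0 !hat0 dotC dot0r oppr0 (achar0 chiP) mulr1 conj_natr.
transitivity (\sum_m hat A m * (hat B (r.1^T *m m))^* * chi (- dot m r.2)); last first.
  by rewrite (bigD1 0) //= addrC.
rewrite natr_sum mulr_sumr.
under [RHS]eq_bigr => m _ do rewrite mulrAC {1}/set_hat !mulr_suml.
rewrite exchange_big /=; apply: eq_bigr => x _.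
rewrite natr_sum mulr_sumr.
under [RHS]eq_bigr => m _ do rewrite rmorph_sum /= mulr_sumr.
rewrite exchange_big /=; apply: eq_bigr => y _.
rewrite -subr_eq0 mulrC -(sum_achar_dot chiP nt); apply: eq_bigr => m _.
rewrite -(acharN chiP) -!(acharD chiP); congr (chi _).
rewrite dot_mulmx trmxK dotDr dotNr dotDr. ring.
Qed.

(** Sort the g by the value n = g^T m, which lies on the sphere of m, and use that
    each n is attained at most as often as a stabiliser is large; then sum over
    m first, which produces the energy on the sphere of n. *)
Lemma sum_orthogonal_le (A B : {set V}) : good_dim F d ->
  \sum_(g in O) \sum_(m | m != 0) `|hat A m| ^+ 2 * `|hat B (g^T *m m)| ^+ 2 <=
  (4 ^ d.-1 * #|F| ^ 'C(d.-1, 2))%:R *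
  (2%:R * (q ^+ d.-1 * #|A|%:R + sqrtC q ^+ d.-1 * #|A|%:R ^+ 2)) *
  (q ^+ d * #|B|%:R).
Proof.
move=> gd; set St := (4 ^ d.-1 * _)%N; set En := 2%:R * _.
rewrite exchange_big /=.
apply: (@le_trans _ _ (\sum_(m | m != 0) \sum_(n | sqnorm n == sqnorm m)
    St%:R * `|hat A m| ^+ 2 * `|hat B n| ^+ 2)).
  apply: ler_sum => m m0; rewrite (partition_big (fun g : 'M[F]_d => g^T *m m)
    (fun n => sqnorm n == sqnorm m)) /=; last first.
    by move=> g gO; rewrite orthogonal_sqnorm // orthogonal_trmx.
  apply: ler_sum => n _.
  rewrite (eq_bigr (fun=> `|hat A m| ^+ 2 * `|hat B n| ^+ 2)); last first.
    by move=> g /andP[_ /eqP->].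
  rewrite sumr_const -[leLHS]mulr_natl -[leRHS]mulrA.
  rewrite ler_wpM2r ?mulr_ge0 ?exprn_ge0 ?normr_ge0 //.
  rewrite ler_nat; apply: leq_trans (card_orthogonal_transport oddF n m0).
  have inj : injective (@trmx F d d) by exact: trmx_inj.
  rewrite -[leqLHS](card_imset _ inj); apply: subset_leq_card; apply/subsetP.
  move=> _ /imsetP[g gI ->]; rewrite inE; move: gI; rewrite inE => /andP[gO gm].
  rewrite gm andbT; apply/forallP => x.
  by rewrite orthogonal_sqnorm // orthogonal_trmx.
rewrite (exchange_big_dep predT) //= -plancherel_set mulr_sumr.
apply: ler_sum => n _; rewrite -mulr_suml ler_wpM2r ?exprn_ge0 ?normr_ge0 //.
rewrite -mulr_sumr ler_wpM2l ?ler0n //.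
apply: le_trans (sphere_energy pF oddF chiF A (sqnorm n) gd).
rewrite [leRHS]big_mkcond [leLHS]big_mkcond; apply: ler_sum => m _ /=.
rewrite [sqnorm n == _]eq_sym.
by case: (m != 0); case: (sqnorm m == _); rewrite /= ?lexx ?exprn_ge0 ?normr_ge0.
Qed.

(** Extending the sum over R to all pairs (g, z) loses little and makes
    Plancherel available in z. *)
Theorem incidence_fluctuation_bound (A B : {set V}) (R : {set 'M[F]_d * V}) :
  good_dim F d -> R \subset rigid_motions F d ->
  `|q ^+ d * (num_incidences (setX A B) R)%:R - #|A|%:R * #|B|%:R * #|R|%:R| ^+ 2
    <= #|R|%:R * (q ^+ d * ((4 ^ d.-1 * #|F| ^ 'C(d.-1, 2))%:R *
  (2%:R * (q ^+ d.-1 * #|A|%:R + sqrtC q ^+ d.-1 * #|A|%:R ^+ 2)) *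
  (q ^+ d * #|B|%:R))).
Proof.
move=> gd /subsetP RO; rewrite num_incidences_expand.
apply: (le_trans (sqr_norm_sum_le _ _)); rewrite ler_wpM2l ?ler0n //.
apply: le_trans (ler_wpM2l _ (sum_orthogonal_le A B gd)); last by rewrite exprn_ge0 ?ltW.
apply: (@le_trans _ _ (\sum_(g in O) \sum_z
    `|incidence_fluctuation A B (g, z)| ^+ 2)).
  rewrite pair_big /= [leRHS]big_mkcond [leLHS]big_mkcond; apply: ler_sum => [[g z]] _ /=.
  have := RO (g, z); case: (_ \in R) => [/(_ isT)|_].
    by rewrite inE /= => /andP[-> _].
  by case: ifP => // _; rewrite exprn_ge0 ?normr_ge0.
rewrite mulr_sumr; apply: ler_sum => g _.
rewrite (plancherel (fun m => hat A m * (hat B (g^T *m m))^*)).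
apply: ler_wpM2l; first by rewrite exprn_ge0 ?ltW.
by apply: ler_sum => m _; rewrite normrM norm_conjC exprMn.
Qed.

End Incidence.

(** * From natural numbers to real powers of q *)

(** In the second range the bound contains sqrt q to the power d - 1, which a
    further squaring removes.  Stated between natural numbers, the estimates
    leave the algebraic numbers and hold in every ordered field. *)
Lemma incidence_discrepancy_nat (F : finFieldType) (d : nat)
    (A B : {set 'cV[F]_d}) (R : {set 'M[F]_d * 'cV[F]_d}) :
  odd #|F| -> good_dim F d -> R \subset rigid_motions F d ->
  let n := `|((#|F| ^ d * num_incidences (setX A B) R)%N%:Z
              - (#|A| * #|B| * #|R|)%N%:Z)%R|%N in
  let Z := (2 * (#|A| * #|B| * #|R|) * 4 ^ d.-1 * #|F| ^ 'C(d.-1, 2)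
              * (#|F| ^ d) ^ 2)%N in
  ((#|A| ^ 2 <= #|F| ^ d.-1 -> n ^ 2 <= 2 * Z * #|F| ^ d.-1) /\
   (#|F| ^ d.-1 <= #|A| ^ 2 ->
      n ^ 4 <= (2 * Z) ^ 2 * (#|F| ^ d.-1 * #|A| ^ 2)))%N.
Proof.
move=> oddF gd RO n Z; have [p p_pr pF] := finPcharP F.
have [chi chiF] : exists chi : F -> algC, frobenius_char p chi.
  have [chi [chiP nt frob]] := absolute_trace_char pF.
  by exists chi; split.
have := incidence_fluctuation_bound pF oddF chiF A B gd RO.
set q := #|F| in n Z *; set a := #|A| in n Z *; set b := #|B| in n Z *.
set r := #|R| in n Z *; set I := num_incidences _ _ in n *.
pose sg : algC := sqrtC q%:R ^+ d.-1.
have sg0 : 0 <= sg by rewrite exprn_ge0 // sqrtC_ge0 ler0n.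
have sg2 : sg ^+ 2 = (q ^ d.-1)%:R by rewrite exprAC sqrtCK natrX.
have -> : q%:R ^+ d * I%:R - a%:R * b%:R * r%:R =
    ((q ^ d * I)%N%:Z - (a * b * r)%N%:Z)%:~R :> algC.
  by rewrite rmorphB /= -!pmulrn !natrM natrX.
rewrite -intr_norm -natr_absz -/n => bnd.
have {}bnd : (n ^ 2)%:R <= Z%:R * ((q ^ d.-1)%:R + sg * a%:R) :> algC.
  rewrite natrX; apply: le_trans bnd _; rewrite le_eqVlt; apply/orP; left; apply/eqP.
  by rewrite /Z /sg !natrM !natrX; ring.
split=> [a_le|a_ge].
  rewrite -(ler_nat algC); apply: le_trans bnd _.
  have -> : (2 * Z * q ^ d.-1)%:R = Z%:R * ((q ^ d.-1)%:R + (q ^ d.-1)%:R) :> algC.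
    by rewrite !natrM; ring.
  rewrite ler_wpM2l ?ler0n // lerD2l -sg2 expr2 ler_wpM2l //.
  by rewrite -(@ler_pXn2r _ 2) ?nnegrE ?ler0n // sg2 -natrX ler_nat.
have sg_a : sg <= a%:R.
  by rewrite -(@ler_pXn2r _ 2) ?nnegrE ?ler0n // sg2 -natrX ler_nat.
have {}bnd : (n ^ 2)%:R <= (2 * Z)%:R * (sg * a%:R) :> algC.
  apply: le_trans bnd _.
  have -> : (2 * Z)%:R * (sg * a%:R) = Z%:R * (sg * a%:R + sg * a%:R) :> algC.
    by rewrite natrM; ring.
  by rewrite ler_wpM2l ?ler0n // lerD2r -sg2 expr2 ler_wpM2l.
rewrite -(ler_nat algC) -[4%N]/(2 * 2)%N expnM natrX.
apply: (@le_trans _ _ (((2 * Z)%:R * (sg * a%:R)) ^+ 2)).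
  by rewrite lerXn2r ?nnegrE ?mulr_ge0 ?ler0n.
rewrite le_eqVlt; apply/orP; left; apply/eqP.
by rewrite !exprMn sg2 !(natrM, natrX); ring.
Qed.

Lemma powR_natX (K : realType) (q n : nat) (x : K) :
  (q%:R `^ x) ^+ n = q%:R `^ (x * n%:R).
Proof. by rewrite -powR_mulrn ?powR_ge0 // powRrM. Qed.

Theorem theorem3p2 (K : realType) (d : nat) :
  exists C : K, 0 < C /\
  forall (F : finFieldType) (q : nat), #|F| = q -> odd q ->
  ((3 <= d)%N /\ odd d) \/ ((d = 2 %[mod 4])%N /\ (q = 3 %[mod 4])%N) ->
  forall (A B : {set 'cV[F]_d}) (R : {set 'M[F]_d * 'cV[F]_d}),
  R \subset rigid_motions F d ->
  let P := setX A B in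
  let D := `| (num_incidences P R)%:R - (#|P|%:R * #|R|%:R) / q%:R ^+ d | in
  (#|A|%:R < q%:R `^ ((d%:R - 1) / 2) :> K ->
   D <= C * (q%:R `^ ((d%:R ^+ 2 - d%:R) / 4)
             * Num.sqrt (#|P|%:R * #|R|%:R)))
  /\
  (q%:R `^ ((d%:R - 1) / 2) <= #|A|%:R :> K ->
   #|A|%:R <= q%:R `^ ((d%:R + 1) / 2) :> K ->
   D <= C * (q%:R `^ ((d%:R ^+ 2 - 2 * d%:R + 1) / 4)
             * Num.sqrt (#|P|%:R * #|R|%:R * #|A|%:R))).
Proof.
exists (2 ^+ d); split; first by rewrite exprn_gt0.
move=> F q <- {q} oddF gd A B R RO P D.
have [case1 case2] := incidence_discrepancy_nat A B oddF gd RO.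
have d1 : (1 < d)%N.
  case: gd => [[d3 _]|[d2 _]]; first exact: ltnW.
  by case: (d) d2 => [|[]].
set q := #|F| in D case1 case2 *; set a := #|A| in case1 case2 *.
set b := #|B| in case1 case2; set r := #|R| in D case1 case2 *.
set n := absz _ in case1 case2.
pose Z := (2 * (a * b * r) * 4 ^ d.-1 * q ^ 'C(d.-1, 2) * (q ^ d) ^ 2)%N.
have cP : #|P| = (a * b)%N by rewrite cardsX.
have dE : d = d.-1.+1 by rewrite prednK // ltnW.
have q0 : 0 < q%:R :> K by rewrite ltr0n odd_gt0.
have qd0 : 0 < q%:R ^+ d :> K by rewrite exprn_gt0.
have DE : D * q%:R ^+ d = n%:R.
  rewrite /D -[X in _ * X]gtr0_norm // -normrM mulrBl divfK ?gt_eqF //.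
  rewrite cP -!natrX -!natrM /n natr_absz intr_norm rmorphB /= -!pmulrn.
  by rewrite mulnC.
have D0 : 0 <= D by exact: normr_ge0.
have powq (m : nat) : q%:R `^ m%:R = (q ^ m)%:R :> K.
  by rewrite powR_mulrn ?ler0n // natrX.
have half : (q%:R `^ ((d%:R - 1) / 2)) ^+ 2 = (q ^ d.-1)%:R :> K.
  rewrite powR_natX divfK ?pnatr_eq0 // -powq; congr (_ `^ _).
  by rewrite {1}dE -addn1 natrD addrK.
have bin2d : (2 * 'C(d.-1, 2) + d.-1 = d.-1 ^ 2)%N.
  case: (d.-1) => // k; rewrite bin2 /= mul2n even_halfK ?oddM /=.
    by rewrite -mulnSr mulnn.
  by case: (odd k).
have dR : d%:R = d.-1%:R + 1 :> K by rewrite {1}dE -addn1 natrD.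
have two_d : (2 ^+ d) ^+ 2 = 4 * (4 ^ d.-1)%:R :> K.
  by rewrite natrX -exprS -dE exprAC; congr (_ ^+ _); ring.
split=> [a_lt|a_ge a_le].
  have {}case1 : (n ^ 2)%N%:R <= (2 * Z * q ^ d.-1)%N%:R :> K.
    rewrite ler_nat; apply: case1; rewrite -(ler_nat K) natrX -half.
    by rewrite lerXn2r ?nnegrE ?ler0n ?powR_ge0 // ltW.
  rewrite -(ler_pM2r qd0) DE -(@ler_pXn2r _ 2) ?nnegrE ?ler0n //; last first.
    by rewrite !mulr_ge0 ?exprn_ge0 ?powR_ge0 ?sqrtr_ge0.
  rewrite -[n%:R ^+ 2]natrX; apply: le_trans case1 _.
  rewrite !exprMn powR_natX sqr_sqrtr ?mulr_ge0 ?ler0n // two_d cP.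
  have -> : (d%:R ^+ 2 - d%:R) / 4 * 2%:R = ('C(d.-1, 2) + d.-1)%:R :> K.
    have := congr1 (fun k => k%:R : K) bin2d; rewrite /= natrD natrM natrX natrD dR => eq2.
    apply: (mulfI (_ : 2 != 0 :> K)); first by rewrite pnatr_eq0.
    transitivity (d.-1%:R ^+ 2 + d.-1%:R : K); first by field.
    by rewrite -eq2; ring.
  rewrite powq expnD le_eqVlt; apply/orP; left; apply/eqP.
  by rewrite !(natrM, natrX); ring.
have {}case2 : (n ^ 4)%N%:R <= ((2 * Z) ^ 2 * (q ^ d.-1 * a ^ 2))%N%:R :> K.
  rewrite ler_nat; apply: case2; rewrite -(ler_nat K) [leRHS]natrX -half.
  by rewrite lerXn2r ?nnegrE ?ler0n ?powR_ge0.
rewrite -(ler_pM2r qd0) DE -(@ler_pXn2r _ 4) ?nnegrE ?ler0n //; last first.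
  by rewrite !mulr_ge0 ?exprn_ge0 ?powR_ge0 ?sqrtr_ge0.
rewrite -[n%:R ^+ 4]natrX; apply: le_trans case2 _.
rewrite !exprMn powR_natX -[4%N in leRHS]/(2 * 2)%N !(exprM _ 2 2).
rewrite sqr_sqrtr ?mulr_ge0 ?ler0n // two_d cP.
have -> : (d%:R ^+ 2 - 2 * d%:R + 1) / 4 * (2 * 2)%:R = (2 * 'C(d.-1, 2) + d.-1)%:R :> K.
  by rewrite bin2d natrM natrX dR; field.
rewrite powq (_ : (2 * 'C(d.-1, 2) + d.-1 = 'C(d.-1, 2) + 'C(d.-1, 2) + d.-1)%N);
  last by rewrite addnn mul2n.
rewrite 2!expnD le_eqVlt; apply/orP; left; apply/eqP.
by rewrite /Z !(natrM, natrX); ring.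
Qed.
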